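(* Let $\alpha$ be a constant positive integer, and suppose the delays of the $m$ resources all belong to a set $\{d_1,\dots,d_\alpha\}$ of $\alpha$ elements. Then an optimal (lowest-cost) assignment of $n$ tasks with arbitrary weights $w_1,\dots,w_n$ to these resources may be found by a dynamic program whose table has size $O(nm^{\alpha})$ and each of whose entries is computed in time $O(n)$, hence in time $O(n^2m^{\alpha})$.
   Context: A problem instance $(T,R)$ consists of a set $R=\{1,\dots,m\}$ of resources, each having a delay (a positive real), and a set $T=\{1,\dots,n\}$ of tasks with real weights $w_1,\dots,w_n\ge 1$. An assignment is a vector $A=(A_1,\dots,A_n)\in\{1,\dots,m\}^n$ (task $i$ is assigned to resource $A_i$). The load of a resource in $A$ is its delay times the sum of the weights of the tasks assigned to it, and the social cost $C(A)$ is the sum over all tasks of the load of the resource to which the task is assigned. An optimal assignment is one minimizing $C$ over all assignments. Here $d_1,\dots,d_\alpha$ denote the possible delay values (not the delays of individual resources). Running time counts elementary arithmetic operations and comparisons; the constants hidden in $O(\cdot)$ may depend on the constant $\alpha$. *)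

(* Defs.v *)
From mathcomp Require Import all_boot all_order all_algebra.
From mathcomp Require Import reals.

Set Implicit Arguments.
Unset Strict Implicit.
Unset Printing Implicit Defensive.

Import Order.TTheory GRing.Theory Num.Theory.
Local Open Scope ring_scope.

(** * Assignments of tasks to resources

    Tasks are ['I_n] with weights [w], resources are ['I_m] with delays [d]. *)

Section Assignments.
Variables (R : realType) (n m : nat) (w : 'I_n -> R) (d : 'I_m -> R).

Definition assignment := {ffun 'I_n -> 'I_m}.

Definition load (A : assignment) (r : 'I_m) : R :=
  d r * \sum_(i | A i == r) w i.

Definition social_cost (A : assignment) : R := \sum_i load A (A i).

Definition optimal (A : assignment) : Prop :=
  forall B : assignment, social_cost A <= social_cost B.

(** The sub-instance [(S, Q)] has only the tasks in [S] and the resources in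
    [Q].  Its assignments are represented by total ones, whose values outside
    [S] are irrelevant. *)

Definition assigns (S : {set 'I_n}) (Q : {set 'I_m}) (A : assignment) : Prop :=
  forall i, i \in S -> A i \in Q.

Definition sub_cost (S : {set 'I_n}) (A : assignment) : R :=
  \sum_(i in S) d (A i) * \sum_(j in S | A j == A i) w j.

Definition is_lowest_cost (S : {set 'I_n}) (Q : {set 'I_m}) (v : R) : Prop :=
  (exists2 A, assigns S Q A & sub_cost S A = v) /\
  (forall A, assigns S Q A -> v <= sub_cost S A).

End Assignments.

(** * A random access machine over the reals

    A program works on finitely many arrays of naturals (indices, counters) and
    of reals, all of unbounded length.  Reals are accessible only through field
    operations and comparisons.  Naturals are combined only by addition and
    truncated subtraction, so that large integers cannot be used to do a lot of
    work in one step. *)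

Inductive nexp :=
| NLit of nat
| NGet of nat & nexp            (* array name, index *)
| NAdd of nexp & nexp
| NSub of nexp & nexp.

Inductive rexp :=
| RLit of nat
| RGet of nat & nexp
| RAdd of rexp & rexp
| RSub of rexp & rexp
| RMul of rexp & rexp
| RDiv of rexp & rexp.

Inductive bexp :=
| NLe of nexp & nexp
| RLe of rexp & rexp
| BNot of bexp
| BAnd of bexp & bexp.

(** [For a e c] runs [c] once for each [k] from [0] to [N - 1], where [N] is the
    value of [e] on entering the loop; before each round, [k] is stored in cell
    [0] of the array [a] of naturals. *)
Inductive cmd :=
| Skip
| NSet of nat & nexp & nexp     (* array name, index, value *)
| RSet of nat & nexp & rexp
| Seq of cmd & cmd
| If of bexp & cmd & cmd
| For of nat & nexp & cmd.

Record state (R : Type) := State {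
  nmem : nat -> nat -> nat;     (* array name, index *)
  rmem : nat -> nat -> R
}.

Definition upd (T : Type) (f : nat -> nat -> T) (a i : nat) (v : T) :=
  fun b j => if (b == a) && (j == i) then v else f b j.

(** Running time: each literal, memory access, operation, comparison and
    connective, and each command and each round of a loop, costs one unit. *)

Fixpoint ncost (e : nexp) : nat :=
  match e with
  | NLit _ => 1
  | NGet _ e1 => (ncost e1).+1
  | NAdd e1 e2 | NSub e1 e2 => (ncost e1 + ncost e2).+1
  end.

Fixpoint rcost (e : rexp) : nat :=
  match e with
  | RLit _ => 1
  | RGet _ e1 => (ncost e1).+1
  | RAdd e1 e2 | RSub e1 e2 | RMul e1 e2 | RDiv e1 e2 =>
      (rcost e1 + rcost e2).+1
  end.

Fixpoint bcost (b : bexp) : nat :=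
  match b with
  | NLe e1 e2 => (ncost e1 + ncost e2).+1
  | RLe e1 e2 => (rcost e1 + rcost e2).+1
  | BNot b1 => (bcost b1).+1
  | BAnd b1 b2 => (bcost b1 + bcost b2).+1
  end.

Section Semantics.
Variable R : realType.
Implicit Type s : state R.

Definition nset a i v s := State (upd (nmem s) a i v) (rmem s).
Definition rset a i v s := State (nmem s) (upd (rmem s) a i v).

Fixpoint neval s (e : nexp) : nat :=
  match e with
  | NLit k => k
  | NGet a e1 => nmem s a (neval s e1)
  | NAdd e1 e2 => (neval s e1 + neval s e2)%N
  | NSub e1 e2 => (neval s e1 - neval s e2)%N
  end.

Fixpoint reval s (e : rexp) : R :=
  match e with
  | RLit k => k%:R
  | RGet a e1 => rmem s a (neval s e1)
  | RAdd e1 e2 => reval s e1 + reval s e2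
  | RSub e1 e2 => reval s e1 - reval s e2
  | RMul e1 e2 => reval s e1 * reval s e2
  | RDiv e1 e2 => reval s e1 / reval s e2
  end.

Fixpoint beval s (b : bexp) : bool :=
  match b with
  | NLe e1 e2 => (neval s e1 <= neval s e2)%N
  | RLe e1 e2 => reval s e1 <= reval s e2
  | BNot b1 => ~~ beval s b1
  | BAnd b1 b2 => beval s b1 && beval s b2
  end.

(** The final state, and the running time. *)
Fixpoint run (c : cmd) (s : state R) : state R * nat :=
  match c with
  | Skip => (s, 1%N)
  | NSet a e1 e2 =>
      (nset a (neval s e1) (neval s e2) s, (ncost e1 + ncost e2).+1)
  | RSet a e1 e2 =>
      (rset a (neval s e1) (reval s e2) s, (ncost e1 + rcost e2).+1)
  | Seq c1 c2 =>
      let r1 := run c1 s in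
      let r2 := run c2 r1.1 in
      (r2.1, (r1.2 + r2.2).+1)
  | If b c1 c2 =>
      let r := run (if beval s b then c1 else c2) s in
      (r.1, (bcost b + r.2).+1)
  | For a e c1 =>
      iteri (neval s e)
        (fun k st => let r := run c1 (nset a 0%N k st.1) in
                     (r.1, (st.2 + r.2).+1))
        (s, (ncost e).+1)
  end.

Definition after (c : cmd) s : state R := (run c s).1.
Definition time (c : cmd) s : nat := (run c s).2.

End Semantics.

(** Input and output conventions. *)

Definition size_arr := 0%N.     (* naturals: [n] in cell 0, [m] in cell 1 *)
Definition out_arr := 1%N.      (* naturals: the resource of task [i] in cell [i] *)
Definition cell_arr := 2%N.     (* naturals: the current table cell in cell 0 *)
Definition weight_arr := 0%N.   (* reals *)
Definition delay_arr := 1%N.    (* reals *)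
Definition table_arr := 2%N.    (* reals *)

Definition input (R : realType) (n m : nat) (w : 'I_n -> R) (d : 'I_m -> R) :
    state R :=
  State
    (fun a k => if a == size_arr then
                  if k == 0%N then n else if k == 1%N then m else 0%N
                else 0%N)
    (fun a k => if a == weight_arr then oapp w 0 (insub k)
                else if a == delay_arr then oapp d 0 (insub k)
                else 0).

Definition outputs (R : realType) (n m : nat) (s : state R)
    (A : assignment n m) : Prop :=
  forall i : 'I_n, nmem s out_arr i = A i.

(** * Dynamic programs

    After [setup], the cells [0, 1, ...] of the table are filled in turn, by the
    same code [entry]; then [readout] extracts the answer. *)

Record dynprog := DynProg {
  setup : cmd;
  entries : nexp;               (* number of table entries, evaluated after [setup] *)
  entry : cmd;
  readout : cmd
}.

Definition dp_cmd (D : dynprog) : cmd :=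
  Seq (setup D) (Seq (For cell_arr (entries D) (entry D)) (readout D)).

Section DynamicPrograms.
Variables (R : realType) (D : dynprog) (s0 : state R).

Definition table_size : nat := neval (after (setup D) s0) (entries D).

Definition after_entries (k : nat) : state R :=
  after (Seq (setup D) (For cell_arr (NLit k) (entry D))) s0.

Definition table (k : nat) : R := rmem (after_entries table_size) table_arr k.

(** The time to compute entry [k], once all the previous ones are there. *)
Definition entry_time (k : nat) : nat :=
  time (entry D) (nset cell_arr 0%N k (after_entries k)).

Definition setup_time : nat := time (setup D) s0.
Definition readout_time : nat := time (readout D) (after_entries table_size).
Definition total_time : nat := time (dp_cmd D) s0.

(** The table is empty at first, and step [k] writes nothing in the table but
    entry [k]. *)
Definition fills_in_order : Prop :=
  (forall j, rmem (after_entries 0) table_arr j = 0) /\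
  (forall k j, (k < table_size)%N -> j != k ->
     rmem (after_entries k.+1) table_arr j = rmem (after_entries k) table_arr j).

(** Each entry holds the lowest cost of some sub-instance, and the whole instance
    is one of these.  Nothing is asked of the value stored for a sub-instance
    without assignments. *)
Definition tabulates_subinstances (n m : nat) (w : 'I_n -> R) (d : 'I_m -> R) :
    Prop :=
  exists sub : nat -> {set 'I_n} * {set 'I_m},
    (exists2 k, (k < table_size)%N & sub k = ([set: 'I_n], [set: 'I_m])) /\
    (forall k, (k < table_size)%N ->
       (exists A, assigns (sub k).1 (sub k).2 A) ->
       is_lowest_cost w d (sub k).1 (sub k).2 (table k)).

End DynamicPrograms.

(* Main.v *)
Require Import Defs.
From mathcomp Require Import all_boot all_order all_algebra.
From mathcomp Require Import fingroup perm.
From mathcomp Require Import reals.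
From mathcomp Require Import ring lra zify.

Set Implicit Arguments.
Unset Strict Implicit.
Unset Printing Implicit Defensive.

Import Order.TTheory GRing.Theory Num.Theory.
Local Open Scope ring_scope.

(** If resource [r] receives [n_r] tasks of total weight [W_r], the social cost
    is the sum of the [d_r * n_r * W_r], that is, every task of weight [w] on
    [r] contributes [w * (d_r * n_r)].  Exchanging two tasks keeps the numbers
    [n_r], so for fixed numbers the lightest tasks may be given to a resource
    maximizing [d_r * n_r].  With the tasks sorted by decreasing weight, some
    optimal assignment therefore gives a final segment of the tasks to a single
    resource, and only the type of that resource matters.  The lowest cost of
    the first [i] tasks on [k_t] resources of each type [t] hence satisfies
    a recurrence over the [O(n)] pairs of a type and a shorter prefix.  The table
    has [(n + 1) * prod_t (M_t + 1)] entries, where [M_t <= m] is the number of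
    resources of type [t], numbered in mixed radix.  The machine cannot divide
    naturals, so the digits of the current entry are kept in a counter. *)

(** * Exchange argument *)

Section SubCost.
Variables (R : realType) (n m : nat) (w : 'I_n -> R) (d : 'I_m -> R).
Implicit Types (S : {set 'I_n}) (Q : {set 'I_m}) (A B : assignment n m).

(** The program is fixed before the instance and knows only [alpha], so the types of the resources
    and the order of the tasks have to be found by comparisons. Resources of one type are
    interchangeable: whenever [k] of them are available, they may be taken to be those numbered
    below [k], and a transposition of resources restores this form after the exchange argument. The
    final segment may be empty, so a step of the recurrence always uses up exactly one resource,
    even one that receives no task; hence [m] rounds are enough to read an assignment out. A cell
    with tasks but without resources has no assignment, which is why feasibility is recorded apart
    from the cost. Segment sizes and weights are differences of prefix sums, so one option is
    evaluated in constant time. In the setup, in one entry and in the readout, loop bounds are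
    literals or come from the sizes [n] and [m]; their running times are thus bounded by recursion
    on the code, independently of the invariants. *)

Definition tasks_on S A r : {set 'I_n} := [set x in S | A x == r].

Lemma mem_tasks_on S A r x : (x \in tasks_on S A r) = (x \in S) && (A x == r).
Proof. by rewrite inE. Qed.

Lemma social_costE A : social_cost w d A = sub_cost w d [set: 'I_n] A.
Proof.
rewrite /social_cost /sub_cost /load; apply: eq_big => [i|i _]; first by rewrite inE.
by congr (_ * _); apply: eq_bigl => j; rewrite inE.
Qed.

Lemma eq_sub_cost S A B : {in S, A =1 B} -> sub_cost w d S A = sub_cost w d S B.
Proof.
move=> eqAB; apply: eq_bigr => i iS; rewrite (eqAB _ iS); congr (_ * _).
by apply: eq_bigl => j; case: (boolP (j \in S)) => //= /eqAB ->.
Qed.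

(** Interchange of the two sums: the weight of [j] is counted once for each task that shares its
    resource. *)
Lemma sub_cost_weights S A : sub_cost w d S A =
  \sum_(j in S) w j * (d (A j) * #|tasks_on S A (A j)|%:R).
Proof.
rewrite /sub_cost; under eq_bigr do rewrite mulr_sumr.
rewrite (exchange_big_dep [in S]) /=; last by move=> i j _ /andP[].
apply: eq_bigr => j jS.
rewrite (eq_bigr (fun=> d (A j) * w j)); last by move=> i /andP[_ /andP[_ /eqP ->]].
rewrite (eq_bigl [in tasks_on S A (A j)]); last first.
  by move=> i; rewrite !inE jS [A j == _]eq_sym.
by rewrite sumr_const -mulr_natr; ring.
Qed.

(** Loads of different resources do not interact, and all the tasks on [r] see the same load. *)
Lemma sub_cost_split S A r : sub_cost w d S A =
  sub_cost w d (S :\: tasks_on S A r) A +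
  d r * #|tasks_on S A r|%:R * \sum_(x in tasks_on S A r) w x.
Proof.
set T := tasks_on S A r.
have TS : S :&: T = T by apply/setIidPr/subsetP => x; rewrite inE => /andP[].
rewrite [LHS](big_setID T) /= TS addrC; congr (_ + _).
  apply: eq_bigr => i; rewrite !inE => /andP[+ iS]; rewrite iS /= => Ai.
  congr (_ * _); apply: eq_bigl => j; rewrite !inE.
  by case: (j \in S) => //=; case: (A j =P A i) => [->|]; rewrite ?andbF // Ai.
rewrite (eq_bigr (fun=> d r * \sum_(x in T) w x)).
  by rewrite sumr_const -mulr_natr; ring.
move=> i; rewrite inE => /andP[_ /eqP ->]; congr (_ * _).
by apply: eq_bigl => j; rewrite inE.
Qed.

Definition swap (a b : 'I_n) A : assignment n m := [ffun x => A (tperm a b x)].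

Lemma mem_tperm S a b x : a \in S -> b \in S -> (tperm a b x \in S) = (x \in S).
Proof. by move=> aS bS; case: tpermP => [->|->|//]; rewrite ?aS ?bS. Qed.

Lemma card_tasks_on_swap S A a b r : a \in S -> b \in S ->
  #|tasks_on S (swap a b A) r| = #|tasks_on S A r|.
Proof.
move=> aS bS; rewrite -(card_imset (tasks_on S A r) (@perm_inj _ (tperm a b))).
apply: eq_card => x; rewrite !inE ffunE; apply/andP/imsetP => [[xS xr]|[y + ->]].
  by exists (tperm a b x); rewrite ?tpermK // inE mem_tperm // xS.
by rewrite inE mem_tperm // tpermK => /andP[].
Qed.

(** The swap keeps the numbers of tasks, hence the coefficients [c r]. The cost therefore drops by
    the product of [w a - w b] and [c (A a) - c (A b)], both nonnegative: the rearrangement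
    inequality for two terms. *)
Lemma sub_cost_swap S A a b : a \in S -> b \in S -> w b <= w a ->
  d (A b) * #|tasks_on S A (A b)|%:R <= d (A a) * #|tasks_on S A (A a)|%:R ->
  sub_cost w d S (swap a b A) <= sub_cost w d S A.
Proof.
move=> aS bS wba; rewrite !sub_cost_weights.
pose c r := d r * #|tasks_on S A r|%:R; rewrite -!/(c _) => cba.
rewrite [leLHS](eq_bigr (fun j => w j * c (A (tperm a b j)))); last first.
  by move=> j _; rewrite card_tasks_on_swap // ffunE.
have [->|neq_ab] := eqVneq a b; first by under eq_bigr do rewrite tperm1 perm1.
have baS : (b \in S) && (b != a) by rewrite bS eq_sym.
rewrite (bigD1 a aS) (bigD1 b baS) /= [leRHS](bigD1 a aS).
rewrite [X in _ <= _ + X](bigD1 b baS) /=.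
rewrite tpermL tpermR.
rewrite (eq_bigr (fun j => w j * c (A j))); last first.
  by move=> j /andP[/andP[_ ja] jb]; rewrite tpermD // eq_sym.
by rewrite -!/(c _); nra.
Qed.

(** Lets the resource of the final segment be taken as the last available one of its type. *)
Lemma sub_cost_relabel S A (r r' : 'I_m) : d r = d r' ->
  sub_cost w d S [ffun x => tperm r r' (A x)] = sub_cost w d S A.
Proof.
move=> drr'; apply: eq_bigr => i _; rewrite ffunE; congr (_ * _).
  by case: tpermP => [->|->|].
by apply: eq_bigl => j; rewrite !ffunE (inj_eq perm_inj).
Qed.

Variable pos : 'I_n -> nat.
Hypothesis pos_inj : injective pos.
Hypothesis pos_weight : forall x y, (pos x < pos y)%N -> w y <= w x.

Definition prefix_tasks (i : nat) : {set 'I_n} := [set x | pos x < i]%N.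

(* By the weighted-sum form of the cost, giving the lightest tasks to the
   resource maximizing [d r * #tasks] cannot increase it. *)
Lemma tail_resource (i : nat) Q A :
  assigns (prefix_tasks i) Q A -> Q != set0 ->
  exists r B (i' : nat), [/\ r \in Q, assigns (prefix_tasks i) Q B,
    sub_cost w d (prefix_tasks i) B <= sub_cost w d (prefix_tasks i) A,
    (i' <= i)%N &
    tasks_on (prefix_tasks i) B r = prefix_tasks i :\: prefix_tasks i'].
Proof.
set S := prefix_tasks i => AQ /set0Pn [r0 r0Q].
pose load_of r := d r * #|tasks_on S A r|%:R.
have [r rQ rmax] : exists2 r, r \in Q & forall q, q \in Q -> load_of q <= load_of r.
  by case: (arg_maxP load_of r0Q) => r rQ rmax; exists r => // q /rmax.
(* Exchanges stay among assignments with the same numbers of tasks, so that [r], chosen from the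
   numbers of [A], remains a maximizer for all of them. *)
pose ok (B : assignment n m) := [&& [forall x in S, B x \in Q],
  [forall q, #|tasks_on S B q| == #|tasks_on S A q|] &
  sub_cost w d S B <= sub_cost w d S A].
have okA : ok A.
  by apply/and3P; split=> //; [apply/forall_inP | apply/forallP => q].
(* Potential of the exchange argument: if a task on [r] is followed by one that is not, swapping the
   two raises the sum of the positions on [r]. At a maximum the tasks on [r] thus form a final
   segment. *)
pose height (B : assignment n m) := (\sum_(x in tasks_on S B r) pos x)%N.
have [B okB Bmax] := arg_maxnP height okA.
case/and3P: (okB) => /forall_inP BQ /forallP Bcard Bcost.
have up a b : a \in S -> b \in S -> B a = r -> (pos a < pos b)%N -> B b = r.
  move=> aS bS Ba ab; apply/eqP/negP => /negP Bb.
  suff /Bmax : ok (swap a b B).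
    rewrite /= /height leqNgt; apply/negP/negPn.
    have -> : (\sum_(x in tasks_on S (swap a b B) r) pos x =
               \sum_(x in tasks_on S B r) pos (tperm a b x))%N.
      rewrite [LHS](reindex_inj (@perm_inj _ (tperm a b))) /=.
      by apply: eq_bigl => x; rewrite !mem_tasks_on ffunE mem_tperm // tpermK.
    have aT : a \in tasks_on S B r by rewrite mem_tasks_on aS Ba eqxx.
    rewrite (bigD1 a aT) [X in (_ < X)%N](bigD1 a aT) /= tpermL.
    rewrite [X in (_ < _ + X)%N](eq_bigr pos) ?ltn_add2r // => x /andP[xT xa].
    have /andP[_ /eqP Bx] : (x \in S) && (B x == r) by rewrite -mem_tasks_on.
    rewrite tpermD // eq_sym //.
    by apply: contraNneq Bb => <-; rewrite Bx.
  apply/and3P; split.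
  - by apply/forall_inP => x xS; rewrite ffunE BQ // mem_tperm.
  - by apply/forallP => q; rewrite card_tasks_on_swap.
  apply: le_trans Bcost; apply: sub_cost_swap => //; first exact: pos_weight.
  by rewrite !(eqP (Bcard _)) Ba; apply: rmax; apply: BQ.
exists r, B.
(* When [r] has no task the segment is empty; otherwise it begins at the least position on [r]. *)
have [/eqP T0|/set0Pn [x1 x1T]] := boolP (tasks_on S B r == set0).
  by exists i; split=> //; rewrite T0 setDv.
have [x xT xmin] := arg_minnP pos x1T.
have /andP[xS /eqP Bx] : (x \in S) && (B x == r) by rewrite -mem_tasks_on.
have xi : (pos x < i)%N by rewrite inE in xS.
exists (pos x); split=> //; first exact: ltnW.
apply/setP => y; apply/idP/idP => [yT|].
  by rewrite !inE -leqNgt xmin //=; by move: yT; rewrite mem_tasks_on inE => /andP[].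
rewrite !inE -leqNgt leq_eqVlt => /andP[/orP[/eqP/pos_inj <-|xy] yi].
  by rewrite xi Bx eqxx.
by rewrite yi /= (up x y) // inE.
Qed.

End SubCost.

(** * Mixed radix numbering of the table *)

Section MixedRadix.
Local Open Scope nat_scope.
Variables (n : nat) (M : nat -> nat).

(** The lowest position of a cell number has radix [n + 1] and holds the length of the prefix; the
    next ones have radix [M t + 1] and hold the number of available resources of type [t]. The
    stride beyond the last type is the size of the table. *)
Fixpoint stride t := if t is t'.+1 then stride t' * (M t').+1 else n.+1.

Definition digit t c := (c %/ stride t) %% (M t).+1.

(** The cell with prefix [i] and one resource of type [t] fewer. Subtracting the stride lowers digit
    [t], and the other term lowers the prefix, so subtractions alone compute it. *)
Definition previous t i c := c - stride t - (c %% n.+1 - i).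

Lemma stride_gt0 t : 0 < stride t.
Proof. by elim: t => //= t IH; rewrite muln_gt0 IH. Qed.

Lemma stride_dvd t u : t <= u -> stride t %| stride u.
Proof.
move=> /subnKC <-; elim: (u - t) => [|k IH]; first by rewrite addn0.
by rewrite addnS /= dvdn_mulr.
Qed.

Lemma stride_dvdS t u : t < u -> stride t * (M t).+1 %| stride u.
Proof. exact: (@stride_dvd t.+1 u). Qed.

Lemma digit_le t c : digit t c <= M t.
Proof. by rewrite -ltnS ltn_mod. Qed.

Lemma digit_stride_le t c : 0 < digit t c -> stride t <= c.
Proof.
rewrite /digit; case: (leqP (stride t) c) => // lt_c.
by rewrite divn_small // mod0n.
Qed.

Lemma digit0 t : digit t 0 = 0.
Proof. by rewrite /digit div0n mod0n. Qed.

Lemma modnS_if q k :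
  q.+1 %% k.+1 = if q %% k.+1 < k then (q %% k.+1).+1 else 0.
Proof.
rewrite {1}(divn_eq q k.+1) -addnS modnMDl; have := ltn_pmod q (ltn0Sn k).
rewrite ltnS leq_eqVlt => /orP[/eqP ->|lt_k]; first by rewrite ltnn modnn.
by rewrite lt_k modn_small.
Qed.

Lemma dvdnS_mod q k : (k.+1 %| q.+1) = ~~ (q %% k.+1 < k).
Proof. by rewrite /dvdn modnS_if; case: ifP. Qed.

(** When [c] is incremented, a carry enters position [t] exactly if [stride t] divides [c + 1]. It
    goes on to the next position if moreover digit [t] is already maximal. *)
Lemma stride_dvd_next t c :
  (stride t.+1 %| c.+1) = (stride t %| c.+1) && ~~ (digit t c < M t).
Proof.
rewrite /= -dvdnS_mod; case: (boolP (stride t %| c.+1)) => /= [h|]; last first.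
  by apply: contraNF; apply: dvdn_trans; rewrite dvdn_mulr.
have := divnS c (stride_gt0 t); rewrite h add1n => <-.
by rewrite dvdn_divRL // mulnC.
Qed.

Lemma digitS t c : digit t c.+1 =
  if stride t %| c.+1 then (if digit t c < M t then (digit t c).+1 else 0)
  else digit t c.
Proof.
rewrite /digit divnS ?stride_gt0 //; case: ifP => _; last by rewrite add0n.
by rewrite add1n modnS_if.
Qed.

(** Incrementing the last cell carries through all positions, so all its digits are maximal: it
    stands for the whole instance. *)
Lemma digit_last t u : t < u -> digit t (stride u).-1 = M t.
Proof.
move=> tu; have := stride_dvd_next t (stride u).-1.
have -> : (stride u).-1.+1 = stride u by rewrite prednK ?stride_gt0.
rewrite (stride_dvd tu) (stride_dvd (ltnW tu)) => /esym.
by rewrite -leqNgt => Mt; apply/eqP; rewrite eqn_leq digit_le.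
Qed.

Lemma mod_last u : (stride u).-1 %% n.+1 = n.
Proof.
have := dvdnS_mod (stride u).-1 n.
have -> : (stride u).-1.+1 = stride u by rewrite prednK ?stride_gt0.
have -> : n.+1 %| stride u by exact: (stride_dvd (leq0n u)).
by move/esym; rewrite -leqNgt => ?; apply/eqP; rewrite eqn_leq -ltnS ltn_mod.
Qed.

(** Vanishing digits make [c] divisible by one stride after another, and the only multiple of
    [stride u] below [stride u] is 0. *)
Lemma cell_eq0 u c : c < stride u -> c %% n.+1 = 0 ->
  (forall t, t < u -> digit t c = 0) -> c = 0.
Proof.
move=> cu c0 dig0; suff: stride u %| c by rewrite /dvdn modn_small // => /eqP.
elim: u dig0 {cu} => [_|u IH dig0] /=; first by rewrite /dvdn c0.
have du : stride u %| c by apply: IH => t tu; apply: dig0; apply: ltnW.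
by rewrite mulnC -dvdn_divRL // /dvdn -/(digit u c) dig0.
Qed.

Lemma divn_stride c t : c %/ stride t = c %/ n.+1 %/ (stride t %/ n.+1).
Proof. by rewrite -divnMA mulnC divnK // (stride_dvd (leq0n t)). Qed.

Section Previous.
Variables (t i c : nat).
Hypotheses (digit_gt0 : 0 < digit t c) (le_i : i <= c %% n.+1).

(** The cell with prefix [i] and all the digits of [c]. Adding [stride t] back to the previous cell
    gives [low], so that additions are studied instead of borrows. *)
Let low := c - (c %% n.+1 - i).

Let low_eq : low = c %/ n.+1 * n.+1 + i.
Proof.
by rewrite /low {1}(divn_eq c n.+1) subnBA // -addnA [(_ %% _ + _)%N]addnC addnA addnK.
Qed.

Let lt_i : i < n.+1.
Proof. by apply: leq_ltn_trans le_i _; rewrite ltn_mod. Qed.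

Let digit_low u : digit u low = digit u c.
Proof.
by rewrite /digit !(divn_stride _ u) low_eq divnMDl // (divn_small lt_i) addn0.
Qed.

Let previous_low : low = previous t i c + stride t.
Proof.
rewrite /previous subnAC subnK //; apply: digit_stride_le.
by rewrite digit_low.
Qed.

Lemma previous_lt : previous t i c < c.
Proof.
apply: leq_ltn_trans (leq_subr _ _) _; rewrite ltn_subrL stride_gt0.
exact: leq_trans (stride_gt0 t) (digit_stride_le digit_gt0).
Qed.

Lemma previous_mod : previous t i c %% n.+1 = i.
Proof.
have /dvdnP [k Ek] := stride_dvd (leq0n t).
have := congr1 (modn^~ n.+1) previous_low.
by rewrite Ek /= low_eq modnMDl (modn_small lt_i) addnC modnMDl => /esym.
Qed.

Lemma digit_previous u : digit u (previous t i c) = digit u c - (u == t).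
Proof.
set z := previous t i c; have Ez : digit u c = digit u (z + stride t).
  by rewrite -previous_low digit_low.
have := digit_gt0; rewrite -digit_low previous_low -/z Ez.
(* Digit [t] of [z + stride t] is positive, so incrementing digit [t] of [z] does not wrap around.
   Hence higher digits are unaffected, while lower ones are because [stride t] is a multiple of
   their period. *)
rewrite {1}/digit divnDr ?dvdnn // divnn stride_gt0 addn1 => carry.
case: ltngtP => [ut|tu|->]; rewrite /digit.
- have /dvdnP [k Ek] := stride_dvdS ut.
  rewrite Ek mulnA [k * _ * _]mulnAC.
  by rewrite divnDMl ?stride_gt0 // subn0 addnC modnMDl.
- have /dvdnP [k Ek] := stride_dvdS tu.
  rewrite subn0 Ek [k * _]mulnC !divnMA divnDr ?dvdnn // divnn stride_gt0 addn1.
  by rewrite [_.+1 %/ (M t).+1]divnS // /dvdn eqn0Ngt carry.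
rewrite divnDr ?dvdnn // divnn stride_gt0 addn1.
by move: carry; rewrite modnS_if; case: ifP; lia.
Qed.

End Previous.
End MixedRadix.

(** * The recurrence *)

Section Recurrence.
Variables (R : realType) (n m : nat) (w : 'I_n -> R) (d : 'I_m -> R).
Variables (pos : 'I_n -> nat) (alpha : nat) (M : nat -> nat).
Variables (ty num : 'I_m -> nat) (dval : nat -> R).
Hypothesis pos_inj : injective pos.
Hypothesis pos_lt : forall x, (pos x < n)%N.
Hypothesis pos_weight : forall x y, (pos x < pos y)%N -> w y <= w x.
Hypothesis ty_lt : forall r, (ty r < alpha)%N.
Hypothesis resource_ex : forall t k, (t < alpha)%N -> (k < M t)%N ->
  exists2 r, ty r = t & num r = k.
Hypothesis resource_inj : forall r r', ty r = ty r' -> num r = num r' -> r = r'.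
Hypothesis dvalE : forall r, dval (ty r) = d r.

Definition cell_tasks c := prefix_tasks pos (c %% n.+1)%N.
Definition cell_resources c : {set 'I_m} :=
  [set r | num r < digit n M (ty r) c]%N.

Definition prefix_size i : R := #|prefix_tasks pos i|%:R.
Definition prefix_weight i : R := \sum_(x in prefix_tasks pos i) w x.

(** The cost of a resource of type [t] that receives exactly the tasks from position [i] to the end
    of the prefix of [c]. *)
Definition step_cost t i c : R :=
  dval t * (prefix_size (c %% n.+1)%N - prefix_size i) *
  (prefix_weight (c %% n.+1)%N - prefix_weight i).

Definition extend i r (A : assignment n m) : assignment n m :=
  [ffun x => if (pos x < i)%N then A x else r].

Let prefix_sub i j : (i <= j)%N -> prefix_tasks pos i \subset prefix_tasks pos j.
Proof.
by move=> ij; apply/subsetP => x; rewrite !inE => /leq_trans; apply.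
Qed.

Let step_costE r i c : (i <= c %% n.+1)%N -> step_cost (ty r) i c =
  d r * #|cell_tasks c :\: prefix_tasks pos i|%:R *
  \sum_(x in cell_tasks c :\: prefix_tasks pos i) w x.
Proof.
move=> /prefix_sub le_sub; have /setIidPr sub := le_sub; rewrite /step_cost dvalE.
rewrite cardsD sub natrB; last exact: subset_leq_card.
congr (_ * _ * _); rewrite /prefix_weight.
by rewrite (big_setID (prefix_tasks pos i)) /= sub addrAC subrr add0r.
Qed.

Section Options.
Variables (t i c : nat).
Hypotheses (digit_gt0 : (0 < digit n M t c)%N) (le_i : (i <= c %% n.+1)%N).

Let p := previous n M t i c.

Lemma cell_tasks_previous : cell_tasks p = prefix_tasks pos i.
Proof. by rewrite /cell_tasks previous_mod. Qed.

(** Lowering digit [t] removes the last available resource of type [t], the one numbered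
    [digit - 1]. *)
Lemma cell_resources_previous r : ty r = t -> num r = (digit n M t c).-1 ->
  cell_resources p = cell_resources c :\ r.
Proof.
move=> tyr numr; apply/setP => q; rewrite !inE digit_previous //.
have [->|neq_qr] := eqVneq q r.
  by rewrite tyr eqxx numr; lia.
rewrite /=; case: eqP => [tyq|]; last by rewrite subn0.
rewrite tyq; have : num q != num r.
  by apply: contraNneq neq_qr => e; apply/eqP/resource_inj; rewrite ?tyr.
by rewrite numr; lia.
Qed.

Lemma mem_cell_resources r : ty r = t -> num r = (digit n M t c).-1 ->
  r \in cell_resources c.
Proof. by move=> tyr numr; rewrite inE tyr numr prednK. Qed.

(** Attainability in the recurrence. Since [r] is not among the resources of [p], after the
    extension it carries the final segment and nothing else. *)
Lemma extend_option r (A : assignment n m) :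
  ty r = t -> num r = (digit n M t c).-1 ->
  assigns (cell_tasks p) (cell_resources p) A ->
  assigns (cell_tasks c) (cell_resources c) (extend i r A) /\
  sub_cost w d (cell_tasks c) (extend i r A) =
    sub_cost w d (cell_tasks p) A + step_cost t i c.
Proof.
move=> tyr numr; rewrite cell_tasks_previous (cell_resources_previous tyr numr).
move=> AQ; split.
  move=> x _; rewrite ffunE; case: ifP => [xi|_]; last exact: mem_cell_resources.
  by have := AQ x; rewrite inE xi => /(_ isT); rewrite in_setD1 => /andP[].
have tail : tasks_on (cell_tasks c) (extend i r A) r =
    cell_tasks c :\: prefix_tasks pos i.
  apply/setP => x; rewrite in_setD mem_tasks_on andbC ffunE; congr (_ && _).
  rewrite [x \in prefix_tasks _ _]inE; case: ifP => xi; last by rewrite eqxx.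
  by have := AQ x; rewrite inE xi => /(_ isT); rewrite in_setD1 => /andP[/negPf].
rewrite (sub_cost_split _ _ _ _ r) tail -tyr step_costE //; congr (_ + _).
rewrite setDDr setDv set0U (setIidPr (prefix_sub le_i)).
by apply: eq_sub_cost => x; rewrite inE ffunE => ->.
Qed.

End Options.

(** The lower bound in the recurrence: no assignment is cheaper than all options. *)
Lemma best_option c (A : assignment n m) : c != 0%N -> (c < stride n M alpha)%N ->
  assigns (cell_tasks c) (cell_resources c) A ->
  exists t i (B : assignment n m), [/\ (t < alpha)%N, (0 < digit n M t c)%N,
    (i <= c %% n.+1)%N,
    assigns (cell_tasks (previous n M t i c))
            (cell_resources (previous n M t i c)) B &
    sub_cost w d (cell_tasks (previous n M t i c)) B + step_cost t i c
      <= sub_cost w d (cell_tasks c) A].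
Proof.
move=> c_neq0 c_lt AQ.
(* An injection of [n] tasks into [n] positions is onto, so some task has position 0. *)
have pos_onto i : (0 < i <= n)%N -> prefix_tasks pos i != set0.
  case/andP=> i_gt0 i_le; apply/set0Pn.
  have n_gt0 : (0 < n)%N by apply: leq_trans i_le.
  have inj : injective (fun x => Ordinal (pos_lt x)) by move=> x y [] /pos_inj.
  have [g _ gK] := injF_bij inj.
  exists (g (Ordinal n_gt0)); rewrite inE.
  by have /(congr1 val) /= -> := gK (Ordinal n_gt0).
(* Without resources all type digits vanish, and so does the prefix since [A] places its tasks; only
   cell 0 is like that. *)
have Q_neq0 : cell_resources c != set0.
  apply/negP => /eqP Q0.
  have dig0 t : (t < alpha)%N -> digit n M t c = 0%N.
    move=> t_lt; apply/eqP; rewrite -leqn0 leqNgt; apply/negP => dig.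
    have [|r tyr numr] := @resource_ex t (digit n M t c).-1 t_lt.
      by rewrite prednK // digit_le.
    by have := mem_cell_resources dig tyr numr; rewrite Q0 inE.
  case/negP: c_neq0; apply/eqP; apply: cell_eq0 c_lt _ dig0.
  apply/eqP; rewrite -leqn0 leqNgt; apply/negP => mod_gt0.
  have /pos_onto/set0Pn[x xS] : (0 < c %% n.+1 <= n)%N.
    by rewrite mod_gt0 -ltnS ltn_mod.
  by have := AQ x xS; rewrite Q0 inE.
have [q [B [i [qQ BQ B_le le_i tail]]]] := tail_resource d pos_inj pos_weight AQ Q_neq0.
have dig : (0 < digit n M (ty q) c)%N by move: qQ; rewrite inE; case: (digit _ _ _ _).
have [|r tyr numr] := @resource_ex (ty q) (digit n M (ty q) c).-1 (ty_lt q).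
  by rewrite prednK // digit_le.
(* The resource [q] of the segment need not be the last available one of its type; exchanging it
   with the last one, [r], frees [r] for the segment. *)
exists (ty q), i, [ffun x => tperm q r (B x)]; split=> //.
  rewrite cell_tasks_previous // (cell_resources_previous dig le_i tyr numr).
  move=> x xi; rewrite ffunE.
  have xS : x \in cell_tasks c by apply: (subsetP (prefix_sub le_i)).
  have Bx : B x != q.
    apply: contraTneq xi => Bq; have : x \in tasks_on (cell_tasks c) B q.
      by rewrite mem_tasks_on xS Bq eqxx.
    by rewrite tail in_setD => /andP[].
  rewrite in_setD1; case: tpermP => [/eqP|Bxr|_ /eqP ->]; first by rewrite (negPf Bx).
    by rewrite qQ andbT; apply: contraNneq Bx => ->; rewrite Bxr.
  by rewrite BQ.
apply: le_trans B_le; rewrite sub_cost_relabel; last by rewrite -!dvalE tyr.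
rewrite cell_tasks_previous // (sub_cost_split w d (cell_tasks c) B q) tail step_costE //.
by rewrite setDDr setDv set0U (setIidPr (prefix_sub le_i)).
Qed.

End Recurrence.

(** * Reasoning about programs *)

(** A syntactic superset of the arrays of naturals that [c] writes, so that the preservation of an
    array is decided by computation. *)
Fixpoint nmods c : seq nat :=
  match c with
  | Skip | RSet _ _ _ => [::]
  | NSet a _ _ => [:: a]
  | Seq c1 c2 | If _ c1 c2 => nmods c1 ++ nmods c2
  | For a _ c1 => a :: nmods c1
  end.

Fixpoint rmods c : seq nat :=
  match c with
  | Skip | NSet _ _ _ => [::]
  | RSet a _ _ => [:: a]
  | Seq c1 c2 | If _ c1 c2 => rmods c1 ++ rmods c2
  | For _ _ c1 => rmods c1
  end.

Lemma upd_neq (T : Type) (f : nat -> nat -> T) a i v b :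
  b != a -> upd f a i v b = f b.
Proof. by rewrite /upd => /negPf ->. Qed.

(** The loop bounds of all our programs have the same value in all states reached
    from an input, so that running times can be bounded statically. *)
Fixpoint size_bound e : bool :=
  match e with
  | NLit _ => true
  | NGet a (NLit _) => a == size_arr
  | NAdd e1 e2 => size_bound e1 && size_bound e2
  | _ => false
  end.

Fixpoint size_loops c : bool :=
  match c with
  | Skip | RSet _ _ _ => true
  | NSet a _ _ => a != size_arr
  | Seq c1 c2 | If _ c1 c2 => size_loops c1 && size_loops c2
  | For a e c1 => [&& a != size_arr, size_bound e & size_loops c1]
  end.

Section Run.
Variable R : realType.
Implicit Types s st : state R.

Definition framed c s st : Prop :=
  (forall b, b \notin nmods c -> nmem st b = nmem s b) /\
  (forall b, b \notin rmods c -> rmem st b = rmem s b).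

Lemma after_seq c1 c2 s : after (Seq c1 c2) s = after c2 (after c1 s).
Proof. by []. Qed.

Lemma time_seq c1 c2 s :
  time (Seq c1 c2) s = (time c1 s + time c2 (after c1 s)).+1.
Proof. by []. Qed.

Lemma after_if b c1 c2 s :
  after (If b c1 c2) s = after (if beval s b then c1 else c2) s.
Proof. by []. Qed.

Lemma after_for a e c s : after (For a e c) s =
  iteri (neval s e) (fun k st => after c (nset a 0%N k st)) s.
Proof.
rewrite /after /=; elim: (neval s e) => //= k IH.
by rewrite IH.
Qed.

Lemma time_for a e c s : time (For a e c) s = ((ncost e).+1 +
  \sum_(k < neval s e) (time c (nset a 0%N k
     (iteri k (fun k st => after c (nset a 0%N k st)) s))).+1)%N.
Proof.
rewrite /time /=; elim: (neval s e) => [|k IH]; first by rewrite big_ord0 addn0.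
rewrite big_ord_recr /= IH addnA addnS; congr (_ + _).+1.
set r := iteri k _ _.
suff -> : r.1 = iteri k (fun k st => after c (nset a 0%N k st)) s by [].
by rewrite /r; elim: (k) => //= j ->.
Qed.

Lemma frame c s : framed c s (after c s).
Proof.
elim: c s => [|a e1 e2|a e1 e2|c1 IH1 c2 IH2|b c1 IH1 c2 IH2|a e c IH] s.
- by [].
- by split=> // b; rewrite inE => ?; apply: upd_neq.
- by split=> // b; rewrite inE => ?; apply: upd_neq.
- have [n1 r1] := IH1 s; have [n2 r2] := IH2 (after c1 s); rewrite after_seq.
  by split=> b; rewrite /= mem_cat negb_or => /andP[b1 b2]; rewrite ?n2 ?n1 ?r2 ?r1.
- have [n1 r1] := IH1 s; have [n2 r2] := IH2 s; rewrite after_if.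
  by split=> b'; rewrite /= mem_cat negb_or => /andP[b1 b2];
    case: ifP; rewrite ?n2 ?n1 ?r2 ?r1.
rewrite after_for; elim: (neval s e) => //= k [nk rk].
set st := iteri k _ _ in nk rk *; have [n1 r1] := IH (nset a 0%N k st).
split=> b; last by move=> bc; rewrite r1 //= rk.
move=> bc; rewrite n1 ?nk //= ?upd_neq ?nk //; move: bc;
  by rewrite /= inE negb_or => /andP[].
Qed.

(** Invariant rule for loops. The step may also assume the frame condition of the whole loop, so
    invariants need not list what stays unchanged. *)
Lemma for_ind (P : nat -> state R -> Prop) a e c s : P 0%N s ->
  (forall k st, (k < neval s e)%N -> framed (For a e c) s st -> P k st ->
     P k.+1 (after c (nset a 0%N k st))) ->
  P (neval s e) (after (For a e c) s).
Proof.
move=> P0 PS; rewrite after_for.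
suff: forall k, (k <= neval s e)%N ->
  let st := iteri k (fun k st => after c (nset a 0%N k st)) s in
  P k st /\ framed (For a e c) s st by move=> /(_ _ (leqnn _)) [].
elim=> [|k IH] // /= lt_k; have [Pk [nk rk]] := IH (ltnW lt_k).
split; first exact: PS.
set st := iteri k _ _ in nk rk *; have [n1 r1] := frame c (nset a 0%N k st).
split=> b; last by move=> bc; rewrite r1 //= rk.
move=> bc; rewrite n1 ?nk //= ?upd_neq ?nk //; move: bc;
  by rewrite /= inE negb_or => /andP[].
Qed.

(** A conditional is charged for both branches, which avoids maxima in the resulting polynomial. *)
Fixpoint time_bound s c : nat :=
  match c with
  | Skip => 1
  | NSet _ e1 e2 => (ncost e1 + ncost e2).+1
  | RSet _ e1 e2 => (ncost e1 + rcost e2).+1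
  | Seq c1 c2 => (time_bound s c1 + time_bound s c2).+1
  | If b c1 c2 => (bcost b + (time_bound s c1 + time_bound s c2)).+1
  | For _ e c1 => ((ncost e).+1 + neval s e * (time_bound s c1).+1)%N
  end.

Lemma size_bound_eval s st e : size_bound e ->
  nmem st size_arr = nmem s size_arr -> neval st e = neval s e.
Proof.
move=> + E; elim: e => //= [a [] //= k _ /eqP ->|e1 IH1 e2 IH2]; first by rewrite E.
by case/andP=> /IH1 -> /IH2 ->.
Qed.

Lemma size_loops_mods c : size_loops c -> size_arr \notin nmods c.
Proof.
elim: c => //= [a _ _|c1 IH1 c2 IH2|_ c1 IH1 c2 IH2|a e c IH].
- by rewrite inE eq_sym.
- by rewrite mem_cat negb_or => /andP[/IH1 -> /IH2 ->].
- by rewrite mem_cat negb_or => /andP[/IH1 -> /IH2 ->].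
by case/and3P => a0 _ /IH c0; rewrite inE negb_or eq_sym a0.
Qed.

Lemma time_le c s st : size_loops c -> nmem st size_arr = nmem s size_arr ->
  (time c st <= time_bound s c)%N.
Proof.
elim: c st => [|a e1 e2|a e1 e2|c1 IH1 c2 IH2|b c1 IH1 c2 IH2|a e c IH] st //=.
- case/andP=> l1 l2 E; rewrite time_seq ltnS leq_add ?IH1 ?IH2 //.
  by have [-> //] := frame c1 st; apply: size_loops_mods.
- case/andP=> l1 l2 E; rewrite /time /= ltnS leq_add2l.
  case: ifP => _; first exact: leq_trans (IH1 _ l1 E) (leq_addr _ _).
  exact: leq_trans (IH2 _ l2 E) (leq_addl _ _).
case/and3P=> a0 eb lc E; rewrite time_for leq_add2l (size_bound_eval eb E).
rewrite -[X in (_ <= X * _)%N]card_ord -sum_nat_const leq_sum // => k _.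
rewrite ltnS; apply: (IH _ lc); rewrite /= upd_neq 1?eq_sym // -E.
(* The state before round [k] is the final state of the same loop with [k] rounds, so the frame
   property applies to it. *)
have [fr _] : framed (For a (NLit k) c) st (after (For a (NLit k) c) st) by exact: frame.
rewrite after_for /= in fr; apply: fr.
by rewrite inE negb_or eq_sym a0 size_loops_mods.
Qed.

End Run.

(** * Ranks and prefix sums *)

Notation x_var := 3%N (only parsing).
Notation y_var := 4%N (only parsing).
Notation t_var := 5%N (only parsing).
Notation pos_arr := 6%N (only parsing).
Notation type_arr := 7%N (only parsing).
Notation num_arr := 8%N (only parsing).
Notation count_arr := 9%N (only parsing).
Notation types_var := 10%N (only parsing).
Notation last_arr := 11%N (only parsing).
Notation link_arr := 12%N (only parsing).
Notation stride_arr := 13%N (only parsing).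
Notation prefix_var := 14%N (only parsing).
Notation digit_arr := 15%N (only parsing).
Notation feasible_arr := 16%N (only parsing).
Notation type_choice_arr := 17%N (only parsing).
Notation prefix_choice_arr := 18%N (only parsing).
Notation slot_var := 19%N (only parsing).
Notation carry_var := 20%N (only parsing).
Notation low_var := 21%N (only parsing).
Notation z_var := 22%N (only parsing).
Notation prefix_size_arr := 3%N (only parsing).
Notation prefix_weight_arr := 4%N (only parsing).
Notation type_delay_arr := 5%N (only parsing).

Definition nvar a := NGet a (NLit 0).
Definition tasks_exp := NGet size_arr (NLit 0).
Definition resources_exp := NGet size_arr (NLit 1).
Definition succ_exp e := NAdd e (NLit 1).

(** The position of a task is the number of tasks that precede it: heavier ones, and equally heavy
    ones of smaller index. Counting them takes quadratic time and replaces sorting. *)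
Definition rank_test : cmd :=
  let x := nvar x_var in let y := nvar y_var in
  If (BAnd (RLe (RGet weight_arr x) (RGet weight_arr y))
           (BNot (BAnd (RLe (RGet weight_arr y) (RGet weight_arr x)) (NLe x y))))
     (NSet pos_arr x (succ_exp (NGet pos_arr x))) Skip.

Definition rank_tasks : cmd := For x_var tasks_exp (For y_var tasks_exp rank_test).

Definition prefix_test : cmd :=
  let x := nvar x_var in let y := nvar y_var in
  If (NLe (succ_exp (NGet pos_arr y)) x)
     (Seq (RSet prefix_size_arr x (RAdd (RGet prefix_size_arr x) (RLit 1)))
          (RSet prefix_weight_arr x
             (RAdd (RGet prefix_weight_arr x) (RGet weight_arr y))))
     Skip.

Definition sum_prefixes : cmd :=
  For x_var (succ_exp tasks_exp) (For y_var tasks_exp prefix_test).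

Section Setup.
Variable R : realType.
Implicit Types s st : state R.

Definition precedes (f : nat -> R) j x : bool :=
  (f x <= f j) && ~~ ((f j <= f x) && (x <= j)%N).

Lemma after_rank_row s n j : nmem s size_arr 0 = n ->
  nmem (after (For y_var tasks_exp rank_test) s) pos_arr j =
  (nmem s pos_arr j + (j == nmem s x_var 0%N) *
     \sum_(0 <= i < n) precedes (rmem s weight_arr) i (nmem s x_var 0%N))%N.
Proof.
set x := nmem s x_var 0%N; set f := rmem s weight_arr => En.
pose P k st := forall j, nmem st pos_arr j =
  (nmem s pos_arr j + (j == x) * \sum_(0 <= i < k) precedes f i x)%N.
rewrite -En; move: j; apply: (for_ind (P := P)) => [j|k st _ fr Pk j].
  by rewrite big_geq // muln0 addn0.
rewrite big_nat_recr //= after_if /= /upd /= (fr.1 x_var isT) (fr.2 0%N isT) -/x -/f.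
rewrite -/(precedes f k x) mulnDr addnA -Pk; case: (precedes f k x) => /=.
  rewrite /after /= /upd /= (fr.1 x_var isT) -/x.
  by case: eqP => [->|]; rewrite ?mul1n // mul0n addn0.
by rewrite muln0 addn0.
Qed.

Lemma after_rank_tasks s n x : nmem s size_arr 0 = n ->
  (forall j, nmem s pos_arr j = 0%N) -> (x < n)%N ->
  nmem (after rank_tasks s) pos_arr x =
  (\sum_(0 <= i < n) precedes (rmem s weight_arr) i x)%N.
Proof.
set f := rmem s weight_arr => En p0 xn.
pose P k st := forall j, nmem st pos_arr j =
  if (j < k)%N then (\sum_(0 <= i < n) precedes f i j)%N else 0%N.
suff /(_ x) : P n (after rank_tasks s) by rewrite xn.
rewrite -{1}En; apply: (for_ind (P := P)) => [j|k st _ fr Pk j]; first exact: p0.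
rewrite (@after_rank_row _ n) /= /upd /= ?(fr.1 0%N isT) // (fr.2 0%N isT) -/f.
rewrite /upd /= Pk ltnS [(j <= k)%N]leq_eqVlt; case: eqP => [->|] /=;
  rewrite ?ltnn ?add0n ?mul1n //.
by rewrite mul0n addn0.
Qed.

Lemma after_prefix_row s n j : nmem s size_arr 0 = n ->
  let st := after (For y_var tasks_exp prefix_test) s in
  let x := nmem s x_var 0%N in
  rmem st prefix_size_arr j = rmem s prefix_size_arr j +
    (if j == x then
       \sum_(0 <= i < n) (if (nmem s pos_arr i < x)%N then 1 else 0) else 0) /\
  rmem st prefix_weight_arr j = rmem s prefix_weight_arr j +
    (if j == x then
       \sum_(0 <= i < n)
         (if (nmem s pos_arr i < x)%N then rmem s weight_arr i else 0) else 0).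
Proof.
move=> En st x; set f := rmem s weight_arr; set p := nmem s pos_arr.
pose P k st := forall j, rmem st prefix_size_arr j = rmem s prefix_size_arr j +
    (if j == x then \sum_(0 <= i < k) (if (p i < x)%N then 1 else 0) else 0) /\
  rmem st prefix_weight_arr j = rmem s prefix_weight_arr j +
    (if j == x then \sum_(0 <= i < k) (if (p i < x)%N then f i else 0) else 0).
rewrite -En; move: j; apply: (for_ind (P := P)) => [j|k st' _ fr Pk j].
  by rewrite !big_geq //; case: eqP; rewrite !addr0.
rewrite !big_nat_recr //=.
have Pj := Pk j.
rewrite after_if /= /upd /= (fr.1 x_var isT) (fr.1 pos_arr isT) -/x -/p addn1.
case: ifP => _ /=; last by rewrite !addr0.
rewrite /after /= /upd /= (fr.1 x_var isT) -/x (fr.2 0%N isT) -/f.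
by case: eqP Pj => [->|_] [-> ->]; rewrite ?eqxx ?addrA.
Qed.

Lemma after_sum_prefixes s n x : nmem s size_arr 0 = n ->
  (forall j, rmem s prefix_size_arr j = 0) ->
  (forall j, rmem s prefix_weight_arr j = 0) -> (x <= n)%N ->
  rmem (after sum_prefixes s) prefix_size_arr x =
    \sum_(0 <= i < n) (if (nmem s pos_arr i < x)%N then 1 else 0) /\
  rmem (after sum_prefixes s) prefix_weight_arr x =
    \sum_(0 <= i < n) (if (nmem s pos_arr i < x)%N then rmem s weight_arr i else 0).
Proof.
set f := rmem s weight_arr; set p := nmem s pos_arr => En z1 z2 xn.
pose P k st := forall j,
  rmem st prefix_size_arr j =
    (if (j < k)%N then \sum_(0 <= i < n) (if (p i < j)%N then 1 else 0) else 0) /\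
  rmem st prefix_weight_arr j =
    (if (j < k)%N then \sum_(0 <= i < n) (if (p i < j)%N then f i else 0) else 0).
suff /(_ x) : P n.+1 (after sum_prefixes s) by rewrite ltnS xn.
have -> : n.+1 = neval s (succ_exp tasks_exp) by rewrite /= -En addn1.
apply: (for_ind (P := P)) => [j|k st _ fr Pk j]; first by rewrite z1 z2.
have [|-> ->] := @after_prefix_row (nset x_var 0%N k st) n j.
  by rewrite /= /upd /= (fr.1 0%N isT).
rewrite /= /upd /= (fr.2 0%N isT) (fr.1 pos_arr isT) -/f -/p /upd /=.
have [-> ->] := Pk j; rewrite ltnS [(j <= k)%N]leq_eqVlt.
by case: eqP => [->|] /=; rewrite ?ltnn ?add0r ?addr0.
Qed.

End Setup.

(** * Types of resources *)

Section TypesCmd.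
Variable alpha : nat.

Definition slot_test : cmd :=
  let x := nvar x_var in let y := nvar y_var in
  If (BAnd (NLe (succ_exp y) (nvar types_var))
       (BAnd (RLe (RGet type_delay_arr y) (RGet delay_arr x))
             (RLe (RGet delay_arr x) (RGet type_delay_arr y))))
     (NSet slot_var (NLit 0) y) Skip.

(** The initial value of [slot_var], the number of types found so far, stands for a new type and
    survives if no known delay matches. *)
Definition find_slot : cmd :=
  Seq (NSet slot_var (NLit 0) (nvar types_var)) (For y_var (NLit alpha) slot_test).

(* [type_arr] and [num_arr] are never read: they let the invariants speak of the
   type of a resource and of its number within the type. *)
Definition fill_slot : cmd :=
  let x := nvar x_var in let slot := nvar slot_var in
  Seq (RSet type_delay_arr slot (RGet delay_arr x))
 (Seq (NSet type_arr x slot)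
 (Seq (NSet num_arr x (NGet count_arr slot))
 (Seq (NSet link_arr x (NGet last_arr slot))
 (Seq (NSet last_arr slot x)
 (Seq (NSet count_arr slot (succ_exp (NGet count_arr slot)))
      (If (NLe (nvar types_var) slot)
          (NSet types_var (NLit 0) (succ_exp (nvar types_var))) Skip)))))).

Definition find_types : cmd :=
  For x_var resources_exp (Seq find_slot fill_slot).

(** Multiplication by [count + 1] through repeated addition, starting from a copy of the stride. The
    surrounding loop has [m] rounds, as its bound must come from the sizes; the test lets only the
    first [count] of them act. *)
Definition stride_step : cmd :=
  let y := nvar y_var in
  If (NLe (succ_exp (nvar z_var)) (NGet count_arr y))
     (NSet stride_arr (succ_exp y)
        (NAdd (NGet stride_arr (succ_exp y)) (NGet stride_arr y)))
     Skip.

Definition find_strides : cmd :=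
  let y := nvar y_var in
  Seq (NSet stride_arr (NLit 0) (succ_exp tasks_exp))
      (For y_var (NLit alpha)
         (Seq (NSet stride_arr (succ_exp y) (NGet stride_arr y))
              (For z_var resources_exp stride_step))).

End TypesCmd.

(** [f j] is the delay of resource [j]; the first [k] resources have been
    sorted into [ntypes] types, resource [j] being the [num j]-th of type
    [ty j].  The resources of a type are chained from [last] through [link]. *)
Record typing (R : realType) (f : nat -> R) (ntypes : nat) (dv : nat -> R)
    (ty num count last link : nat -> nat) (k : nat) : Prop := Typing {
  typing_uniq : forall t t', (t < ntypes)%N -> (t' < ntypes)%N ->
    dv t = dv t' -> t = t';
  typing_old : forall t, (t < ntypes)%N -> exists2 j, (j < k)%N & dv t = f j;
  typing_ty : forall j, (j < k)%N ->
    [/\ (ty j < ntypes)%N, dv (ty j) = f j & (num j < count (ty j))%N];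
  typing_ex : forall t i, (i < count t)%N ->
    exists j, [/\ (j < k)%N, ty j = t & num j = i];
  typing_inj : forall j j', (j < k)%N -> (j' < k)%N ->
    ty j = ty j' -> num j = num j' -> j = j';
  typing_last : forall t, (0 < count t)%N ->
    [/\ (last t < k)%N, ty (last t) = t & num (last t) = (count t).-1];
  typing_link : forall j, (j < k)%N -> (0 < num j)%N ->
    [/\ (link j < k)%N, ty (link j) = ty j & num (link j) = (num j).-1];
  typing_count : forall t, (count t <= k)%N
}.

Section Typing.
Variable R : realType.

(** Resource [k] becomes the last of type [slot]: its number is the old count, its link the old last
    resource. The case [slot = c] opens a new type, whose delay is by assumption different from the
    known ones. *)
Lemma typing_step (f : nat -> R) c dv ty num count last link k slot :
  typing f c dv ty num count last link k -> (slot <= c)%N ->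
  ((slot < c)%N -> dv slot = f k) ->
  (slot = c -> forall t, (t < c)%N -> dv t <> f k) ->
  typing f (if (c <= slot)%N then c.+1 else c)
    [eta dv with slot |-> f k] [eta ty with k |-> slot]
    [eta num with k |-> count slot] [eta count with slot |-> (count slot).+1]
    [eta last with slot |-> k] [eta link with k |-> last slot] k.+1.
Proof.
case=> U O T E I L K C slot_le old new; set c' := if _ then _ else _.
have slot_lt : (slot < c')%N by rewrite /c'; case: (leqP c slot); lia.
have c_le : (c <= c')%N by rewrite /c'; case: ifP => _; rewrite ?leqnSn.
have c'_lt t : (t < c')%N -> t != slot -> (t < c)%N.
  by rewrite /c'; case: (leqP c slot); lia.
have dv_slot t : (t < c)%N -> t != slot -> dv t <> f k.
  move=> tc ts Et; have [lt_c|] := ltnP slot c; last first.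
    by move=> h; apply: new Et => //; lia.
  by case/eqP: ts; apply: U => //; rewrite old.
have ty_k j : (j < k)%N -> j == k = false by move=> ?; apply/eqP; lia.
split=> /=.
- move=> t t' tc t'c; case: eqP => [->|/eqP ts]; case: eqP => [->|/eqP t's] //.
  + by move=> e; case: (dv_slot t') => //; apply: c'_lt.
  + by move=> e; case: (dv_slot t) => //; apply: c'_lt.
  by apply: U; apply: c'_lt.
- move=> t tc; case: eqP => [_|/eqP ts]; first by exists k.
  by have [j jk ->] := O t (c'_lt t tc ts); exists j => //; apply: ltnW.
- move=> j; rewrite ltnS leq_eqVlt; case: eqP => [-> _|_ /= jk]; first by rewrite eqxx.
  have [h1 h2 h3] := T j jk; split; first exact: leq_trans h1 c_le.
    by case: eqP => // e; rewrite -h2 e old // -e.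
  by case: eqP => // e; apply: ltnW; rewrite ltnS -e.
- move=> t i; case: eqP => [->|_].
    rewrite ltnS leq_eqVlt => /orP[/eqP ->|/E [j [jk tyj numj]]].
      by exists k; rewrite eqxx.
    by exists j; rewrite ty_k // ltnS ltnW.
  by move=> /E [j [jk tyj numj]]; exists j; rewrite ty_k // ltnS ltnW.
- move=> j j'; rewrite !ltnS [(j <= k)%N]leq_eqVlt [(j' <= k)%N]leq_eqVlt.
  have [->|_] := eqVneq j k; have [->|_] := eqVneq j' k => //= jk j'k.
  + by move=> tyj numj; have [_ _] := T j' j'k; rewrite -tyj -numj ltnn.
  + by move=> tyj numj; have [_ _] := T j jk; rewrite tyj numj ltnn.
  exact: I.
- move=> t; case: eqP => [-> _|_ /L [h1 h2 h3]]; first by rewrite eqxx.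
  by rewrite ty_k // ltnS ltnW.
- move=> j; rewrite ltnS leq_eqVlt; case: eqP => [-> _|_ /= jk].
    by move=> /L [h1 h2 h3]; rewrite ty_k // ltnS ltnW.
  by move=> /(K j jk) [h1 h2 h3]; rewrite ty_k // ltnS ltnW.
by move=> t; case: eqP => _; [rewrite ltnS | apply: leqW].
Qed.

(** The delays of the types are distinct members of [vs]; this is what makes [alpha] slots
    sufficient. *)
Lemma typing_size (f : nat -> R) c dv ty num count last link k (vs : seq R) :
  typing f c dv ty num count last link k ->
  (forall j, (j < k)%N -> f j \in vs) -> (c <= size vs)%N.
Proof.
case=> U O _ _ _ _ _ _ fvs; rewrite -(size_mkseq dv c); apply: uniq_leq_size.
  rewrite /mkseq map_inj_in_uniq ?iota_uniq // => t t'.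
  by rewrite !mem_iota /= !add0n; apply: U.
move=> _ /mapP [t + ->]; rewrite mem_iota /= add0n => /O [j jk ->].
exact: fvs.
Qed.

Implicit Types s st : state R.

Definition typing_at k st := typing (rmem st delay_arr) (nmem st types_var 0%N)
  (rmem st type_delay_arr) (nmem st type_arr) (nmem st num_arr)
  (nmem st count_arr) (nmem st last_arr) (nmem st link_arr) k.

Lemma after_find_slot alpha s :
  let st := after (find_slot alpha) s in
  let c := nmem s types_var 0%N in
  let slot := nmem st slot_var 0%N in
  let v := rmem s delay_arr (nmem s x_var 0%N) in
  [/\ (slot <= c)%N, (slot < c)%N -> rmem s type_delay_arr slot = v &
      slot = c -> forall t, (t < alpha)%N -> (t < c)%N ->
        rmem s type_delay_arr t <> v].
Proof.
move=> st c; set v := rmem s delay_arr _; set dv := rmem s type_delay_arr.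
pose P k st' := let slot := nmem st' slot_var 0%N in
  [/\ (slot <= c)%N, (slot < c)%N -> dv slot = v &
      slot = c -> forall t, (t < k)%N -> (t < c)%N -> dv t <> v].
rewrite /st /find_slot after_seq.
set s1 := after _ s; rewrite -/(P alpha _) -[X in P X]/(neval s1 (NLit alpha)).
apply: (for_ind (P := P)) => [|k st' _ fr [le_c eq_v neq_v]].
  by rewrite /P /s1 /= /upd /= ltnn; split.
rewrite /P after_if /= /upd /= (fr.1 x_var isT) (fr.1 types_var isT) (fr.2 1%N isT).
rewrite (fr.2 5%N isT) /s1 /after /= /upd /= -/dv -/v -/c addn1.
case: ifP => [/and3P[kc h1 h2]|] /=.
  rewrite /upd /=; split; first exact: ltnW.
    by move=> _; apply/eqP; rewrite eq_le h1.
  by move=> e; move: kc; rewrite e ltnn.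
move=> test; split=> // e t; rewrite ltnS leq_eqVlt => /orP[/eqP ->|]; last exact: neq_v.
by move=> kc ev; move: test; rewrite kc ev lexx.
Qed.

Lemma after_find_types alpha s m (vs : seq R) : nmem s size_arr 1%N = m ->
  (size vs <= alpha)%N -> (forall j, (j < m)%N -> rmem s delay_arr j \in vs) ->
  nmem s types_var 0%N = 0%N -> (forall t, nmem s count_arr t = 0%N) ->
  typing_at m (after (find_types alpha) s) /\
  (nmem (after (find_types alpha) s) types_var 0%N <= alpha)%N.
Proof.
move=> Em size_vs f_vs c0 count0; have [_ fr1] := frame (find_types alpha) s.
have T : typing_at m (after (find_types alpha) s); last first.
  split=> //; apply: leq_trans size_vs; apply: typing_size T _.
  by rewrite fr1.
rewrite -Em; apply: (for_ind (P := typing_at)) => [|k st km fr T].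
  by split; rewrite ?c0 // => t; rewrite ?count0.
rewrite after_seq; set st0 := nset _ _ _ _; set st1 := after _ st0.
have [n1 r1] := frame (find_slot alpha) st0.
have [] := after_find_slot alpha st0; rewrite -/st1.
have -> : nmem st0 x_var 0%N = k by rewrite /= /upd.
have -> : rmem st0 = rmem st by [].
have -> : nmem st0 types_var = nmem st types_var by rewrite /= upd_neq.
set slot := nmem st1 slot_var 0%N => le_c eq_v neq_v.
(* With at most [alpha] types so far, the scan of [alpha] slots has met them all, so a delay not
   found is really new. *)
have c_le : (nmem st types_var 0%N <= alpha)%N.
  apply: leq_trans size_vs; apply: typing_size T _ => j jk.
  by rewrite (fr.2 1%N isT) f_vs // -Em (ltn_trans jk).
have {neq_v} neq_v : slot = nmem st types_var 0%N -> forall t,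
    (t < nmem st types_var 0%N)%N -> rmem st type_delay_arr t <> rmem st delay_arr k.
  by move=> e t tc; apply: neq_v => //; apply: leq_trans c_le.
have := typing_step T le_c eq_v neq_v.
have same b : b \notin [:: x_var; slot_var; y_var] -> nmem st1 b = nmem st b.
  rewrite !inE !negb_or => /and3P[b1 b2 b3].
  by rewrite n1 /= ?upd_neq // !inE !negb_or b2 b3.
have x1 : nmem st1 x_var 0%N = k by rewrite n1 //= /upd.
rewrite /typing_at /fill_slot /after /= /upd /= -/slot x1.
have e9 := same count_arr isT; have e10 := same types_var isT.
have e11 := same last_arr isT.
rewrite e9 e10 e11 (r1 1%N isT) addn1.
case: ifP => _ /=; rewrite /upd /= ?e9 ?e10 ?e11 (same type_arr isT) (same num_arr isT)
  (same link_arr isT) (r1 5%N isT) (r1 1%N isT) ?addn1 //.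
Qed.

Lemma after_stride_loop s m : nmem s size_arr 1%N = m ->
  let st := after (For z_var resources_exp stride_step) s in
  let y := nmem s y_var 0%N in
  (nmem s count_arr y <= m)%N -> forall j, nmem st stride_arr j =
    (nmem s stride_arr j +
     (j == y.+1) * (nmem s count_arr y * nmem s stride_arr y))%N.
Proof.
move=> Em st y le_m; set cy := nmem s count_arr y; set sy := nmem s stride_arr y.
pose P k st' := forall j, nmem st' stride_arr j =
  (nmem s stride_arr j + (j == y.+1) * (minn k cy * sy))%N.
suff: P m st by rewrite /P (minn_idPr le_m).
rewrite -Em; apply: (for_ind (P := P)) => [j|k st' _ fr Pk j].
  by rewrite min0n muln0 addn0.
rewrite after_if /= /upd /= (fr.1 count_arr isT) (fr.1 y_var isT) -/y -/cy addn1.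
have Py : nmem st' stride_arr y = sy by rewrite Pk ltn_eqF // mul0n addn0.
case: (ltnP k cy) => kc.
  rewrite /after /= /upd /= (fr.1 y_var isT) -/y addn1 Py !Pk.
  rewrite (minn_idPl kc) (minn_idPl (ltnW kc)).
  by case: eqP => [->|]; rewrite ?eqxx ?mul1n ?mul0n // mulSn -addnA [(sy + _)%N]addnC.
by rewrite /after /= /upd /= Pk (minn_idPr kc) (minn_idPr (leqW kc)).
Qed.

Lemma after_find_strides alpha s n m t : nmem s size_arr 0%N = n ->
  nmem s size_arr 1%N = m -> (forall t, nmem s count_arr t <= m)%N ->
  (t <= alpha)%N ->
  nmem (after (find_strides alpha) s) stride_arr t = stride n (nmem s count_arr) t.
Proof.
move=> En Em count_le; rewrite /find_strides after_seq; set s1 := after _ s.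
pose P k st := forall t, (t <= k)%N ->
  nmem st stride_arr t = stride n (nmem s count_arr) t.
move: t; rewrite -/(P alpha _) -[X in P X]/(neval s1 (NLit alpha)).
apply: (for_ind (P := P)) => [t|k st _ fr Pk t].
  by rewrite leqn0 => /eqP ->; rewrite /s1 /after /= /upd /= En addn1.
rewrite after_seq; set st1 := after (NSet _ _ _) _ => tk.
have E9 : nmem st1 count_arr = nmem s count_arr.
  by rewrite /st1 /= upd_neq // upd_neq // (fr.1 count_arr isT) /s1 /= upd_neq.
have E0 : nmem st1 0%N = nmem s 0%N.
  by rewrite /st1 /= upd_neq // upd_neq // (fr.1 0%N isT) /s1 /= upd_neq.
have E4 : nmem st1 y_var 0%N = k by rewrite /st1 /= /upd.
rewrite (@after_stride_loop _ m) ?E0 ?E9 // E4.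
rewrite /st1 /after /= /upd /= addn1.
move: tk; rewrite leq_eqVlt => /orP[/eqP ->|tk].
  by rewrite eqxx ltn_eqF // Pk //= mul1n mulnS mulnC.
by rewrite !ltn_eqF // Pk // mul0n addn0.
Qed.

End Typing.

(** * The state after the setup *)

Section Rank.
Variables (R : realType) (n : nat) (f : nat -> R).
Implicit Types x y : 'I_n.

Definition rank (x : nat) : nat := \sum_(0 <= i < n) precedes f i x.

Lemma rankE x : rank x = #|[set i : 'I_n | precedes f i x]|.
Proof.
rewrite /rank big_mkord -sum1_card [RHS]big_mkcond /=.
by apply: eq_bigr => i _; rewrite inE; case: precedes.
Qed.

Lemma precedes_irr j : precedes f j j = false.
Proof. by rewrite /precedes lexx leqnn. Qed.

Lemma precedes_trans i j k : precedes f i j -> precedes f j k -> precedes f i k.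
Proof.
rewrite /precedes => /andP[ji nij] /andP[kj njk].
rewrite (le_trans kj ji) /=; apply/negP => /andP[ik ki].
move: nij njk; rewrite !negb_and.
rewrite (le_trans ik kj) (le_trans ji ik) /= -!ltnNge; lia.
Qed.

Lemma precedes_total i j : i != j -> precedes f i j || precedes f j i.
Proof.
by move=> ij; rewrite /precedes; case: (ltgtP (f i) (f j)) => //= _; lia.
Qed.

(** All predecessors of [x] precede [y], and [x] itself is one more. *)
Lemma precedes_rank x y : precedes f x y -> (rank x < rank y)%N.
Proof.
move=> xy; rewrite !rankE; apply: proper_card; apply/properP; split.
  by apply/subsetP => z; rewrite !inE => /precedes_trans; apply.
by exists x; rewrite inE // precedes_irr.
Qed.

Lemma rank_inj : injective (fun x => rank x).
Proof.
move=> x y; have [//|neq_xy] := eqVneq x y.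
by case/orP: (precedes_total neq_xy) => /precedes_rank; lia.
Qed.

Lemma rank_lt x : (rank x < n)%N.
Proof.
rewrite rankE -[X in (_ < X)%N]card_ord; apply: proper_card.
by apply/properP; split; [apply/subsetP | exists x; rewrite ?inE ?precedes_irr].
Qed.

Lemma rank_weight x y : (rank x < rank y)%N -> f y <= f x.
Proof.
move=> lt_xy; rewrite leNgt; apply/negP => fxy.
have /precedes_rank : precedes f y x by rewrite /precedes ltW // negb_and -ltNge fxy.
lia.
Qed.

End Rank.

Section Prepared.
Variables (R : realType) (alpha n m : nat) (w : 'I_n -> R) (d : 'I_m -> R).

(** Marking cell 0 as feasible is the base case: no task, and cost 0, which the empty table already
    contains. *)
Definition setup_cmd : cmd :=
  Seq rank_tasks (Seq sum_prefixes (Seq (find_types alpha)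
    (Seq (find_strides alpha) (NSet feasible_arr (NLit 0) (NLit 1))))).

Definition pos_of (s : state R) (x : 'I_n) := nmem s pos_arr x.
Definition type_of (s : state R) (r : 'I_m) := nmem s type_arr r.
Definition num_of (s : state R) (r : 'I_m) := nmem s num_arr r.

(** The interface between the setup and the later phases. [prepared_last] and [prepared_link]
    describe one stack per type, from which resources come in decreasing order of their numbers, the
    order in which cells lose them. *)
Record prepared (s : state R) : Prop := Prepared {
  prepared_n : nmem s size_arr 0%N = n;
  prepared_m : nmem s size_arr 1%N = m;
  prepared_pos_inj : injective (pos_of s);
  prepared_pos_lt : forall x, (pos_of s x < n)%N;
  prepared_pos_weight : forall x y, (pos_of s x < pos_of s y)%N -> w y <= w x;
  prepared_prefix_size : forall i, (i <= n)%N ->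
    rmem s prefix_size_arr i = prefix_size R (pos_of s) i;
  prepared_prefix_weight : forall i, (i <= n)%N ->
    rmem s prefix_weight_arr i = prefix_weight w (pos_of s) i;
  prepared_type_lt : forall r, (type_of s r < alpha)%N;
  prepared_resource_ex : forall t k, (t < alpha)%N -> (k < nmem s count_arr t)%N ->
    exists2 r, type_of s r = t & num_of s r = k;
  prepared_resource_inj : forall r r', type_of s r = type_of s r' ->
    num_of s r = num_of s r' -> r = r';
  prepared_num_lt : forall r, (num_of s r < nmem s count_arr (type_of s r))%N;
  prepared_delay : forall r, rmem s type_delay_arr (type_of s r) = d r;
  prepared_last : forall t, (0 < nmem s count_arr t)%N -> exists r : 'I_m,
    [/\ nmem s last_arr t = r, type_of s r = t &
        num_of s r = (nmem s count_arr t).-1];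
  prepared_link : forall r, (0 < num_of s r)%N -> exists r' : 'I_m,
    [/\ nmem s link_arr r = r', type_of s r' = type_of s r &
        num_of s r' = (num_of s r).-1];
  prepared_count : forall t, (nmem s count_arr t <= m)%N;
  prepared_stride : forall t, (t <= alpha)%N ->
    nmem s stride_arr t = stride n (nmem s count_arr) t;
  prepared_table : forall j, rmem s table_arr j = 0;
  prepared_feasible : forall j, nmem s feasible_arr j = (j == 0)%N;
  prepared_digit : forall t, nmem s digit_arr t = 0%N;
  prepared_prefix : nmem s prefix_var 0%N = 0%N
}.

Lemma after_setup (dvals : alpha.-tuple R) : (forall r, d r \in dvals) ->
  prepared (after setup_cmd (input w d)).
Proof.
move=> d_vals; set s0 := input w d.
set W := rmem s0 weight_arr; set D := rmem s0 delay_arr.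
have WE (x : 'I_n) : W x = w x by rewrite /W /= valK.
have DE (r : 'I_m) : D r = d r by rewrite /D /= valK.
rewrite /setup_cmd !after_seq.
set s1 := after rank_tasks s0; set s2 := after sum_prefixes s1.
set s3 := after (find_types alpha) s2; set s4 := after (find_strides alpha) s3.
have [n1 r1] : framed rank_tasks s0 s1 by exact: frame.
have [n2 r2] : framed sum_prefixes s1 s2 by exact: frame.
have [n3 r3] : framed (find_types alpha) s2 s3 by exact: frame.
have [n4 r4] : framed (find_strides alpha) s3 s4 by exact: frame.
set s5 := after _ s4.
have n5 b : b != feasible_arr -> nmem s5 b = nmem s4 b by move=> ?; apply: upd_neq.
have r5 b : rmem s5 b = rmem s4 b by [].
have posE (x : 'I_n) : nmem s5 pos_arr x = rank n W x.
  rewrite n5 // n4 // n3 // n2 //; apply: after_rank_tasks => //.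
have pos2 (x : 'I_n) : nmem s1 pos_arr x = rank n W x.
  by rewrite -posE n5 // n4 // n3 // n2.
have sums i : (i <= n)%N -> rmem s5 prefix_size_arr i = prefix_size R (pos_of s5) i /\
    rmem s5 prefix_weight_arr i = prefix_weight w (pos_of s5) i.
  move=> i_le; rewrite !r5 !r4 // !r3 //.
  have [||||-> ->] // := @after_sum_prefixes _ s1 n i.
  - by rewrite n1.
  - by move=> j; rewrite r1.
  - by move=> j; rewrite r1.
  rewrite !big_mkord /prefix_size /prefix_weight; split.
    rewrite -[RHS]/(_%:R) -sum1_card natr_sum [RHS]big_mkcond /=.
    by apply: eq_bigr => x _; rewrite inE /pos_of posE pos2; case: ifP.
  rewrite [RHS]big_mkcond /=; apply: eq_bigr => x _.
  by rewrite inE /pos_of posE pos2 (r1 0%N isT) -/W WE.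
have [||||T c_le] := @after_find_types R alpha s2 m dvals _ (eq_leq (size_tuple _)).
- by rewrite n2 // n1.
- by move=> j jm; rewrite r2 // r1 // -/D -[j]/(val (Ordinal jm)) DE.
- by rewrite n2 // n1.
- by move=> t; rewrite n2 // n1.
rewrite -/s3 in T c_le.
have [_ _ Tty Tex Tinj Tlast Tlink Tcount] := T.
have dE (r : 'I_m) : rmem s3 delay_arr r = d r by rewrite r3 // r2 // r1.
split.
- by rewrite n5 // n4 // n3 // n2 // n1.
- by rewrite n5 // n4 // n3 // n2 // n1.
- by move=> x y; rewrite /pos_of !posE => /rank_inj.
- by move=> x; rewrite /pos_of posE rank_lt.
- by move=> x y; rewrite /pos_of !posE -!WE; apply: rank_weight.
- by move=> i /sums [].
- by move=> i /sums [].
- by move=> r; rewrite /type_of n5 // n4 //; have [/leq_trans -> ] := Tty r (ltn_ord r).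
- move=> t k _; rewrite /type_of /num_of !n5 // !n4 // => /Tex [j [jm tyj numj]].
  by exists (Ordinal jm).
- move=> r r'; rewrite /type_of /num_of !n5 // !n4 // => e1 e2.
  exact: val_inj (Tinj _ _ (ltn_ord r) (ltn_ord r') e1 e2).
- move=> r; rewrite /type_of /num_of !n5 // !n4 //.
  by have [] := Tty r (ltn_ord r).
- move=> r; rewrite /type_of n5 // r5 n4 // r4 //.
  by have [_ -> _] := Tty r (ltn_ord r); rewrite dE.
- move=> t; rewrite /type_of /num_of !n5 // !n4 // => /Tlast [jm tyj numj].
  by exists (Ordinal jm).
- move=> r; rewrite /type_of /num_of !n5 // !n4 //.
  move=> /(Tlink r (ltn_ord r)) [jm tyj numj].
  by exists (Ordinal jm).
- by move=> t; rewrite n5 // n4.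
- move=> t t_le; rewrite !n5 // [nmem s4 count_arr]n4 //.
  apply: (@after_find_strides _ _ _ _ m) => //; rewrite n3 // n2 // n1 //.
- by move=> j; rewrite r5 r4 // r3 // r2 // r1.
- move=> j; rewrite /s5 /after /= /upd /=; case: eqP => // _.
  by rewrite n4 // n3 // n2 // n1.
- by move=> t; rewrite n5 // n4 // n3 // n2 // n1.
by rewrite n5 // n4 // n3 // n2 // n1.
Qed.

End Prepared.

(** * Filling the table *)

Definition previous_exp t low :=
  NSub (NSub (nvar cell_arr) (NGet stride_arr t)) (NSub (nvar prefix_var) low).

Definition option_exp : rexp :=
  let t := nvar t_var in let y := nvar y_var in let i := nvar prefix_var in
  RAdd (RGet table_arr (previous_exp t y))
    (RMul (RMul (RGet type_delay_arr t)
                (RSub (RGet prefix_size_arr i) (RGet prefix_size_arr y)))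
          (RSub (RGet prefix_weight_arr i) (RGet prefix_weight_arr y))).

(* [feasible_arr] marks the entries whose sub-instance has an assignment: the
   others contain [0], which must not enter the minimum. *)
Definition option_test : cmd :=
  let t := nvar t_var in let y := nvar y_var in let c := nvar cell_arr in
  If (BAnd (NLe (NLit 1) (NGet digit_arr t))
     (BAnd (NLe y (nvar prefix_var))
           (NLe (NLit 1) (NGet feasible_arr (previous_exp t y)))))
     (If (BAnd (NLe (NLit 1) (NGet feasible_arr c))
               (RLe (RGet table_arr c) option_exp))
         Skip
         (Seq (RSet table_arr c option_exp)
         (Seq (NSet type_choice_arr c t)
         (Seq (NSet prefix_choice_arr c y) (NSet feasible_arr c (NLit 1))))))
     Skip.

Definition scan_prefixes : cmd := For y_var (succ_exp tasks_exp) option_test.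

Definition carry_step : cmd :=
  let t := nvar t_var in
  If (NLe (NLit 1) (nvar carry_var))
     (If (NLe (succ_exp (NGet digit_arr t)) (NGet count_arr t))
         (Seq (NSet digit_arr t (succ_exp (NGet digit_arr t)))
              (NSet carry_var (NLit 0) (NLit 0)))
         (NSet digit_arr t (NLit 0)))
     Skip.

Definition prefix_step : cmd :=
  Seq (NSet carry_var (NLit 0) (NLit 0))
      (If (NLe (succ_exp (nvar prefix_var)) tasks_exp)
          (NSet prefix_var (NLit 0) (succ_exp (nvar prefix_var)))
          (Seq (NSet prefix_var (NLit 0) (NLit 0))
               (NSet carry_var (NLit 0) (NLit 1)))).

Section Entry.
Variable alpha : nat.

Definition scan_options : cmd := For t_var (NLit alpha) scan_prefixes.

Definition advance : cmd := Seq prefix_step (For t_var (NLit alpha) carry_step).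

Definition entry_cmd : cmd := Seq scan_options advance.

Definition entries_exp := NGet stride_arr (NLit alpha).

Definition fill_cmd : cmd := For cell_arr entries_exp entry_cmd.

Variables (R : realType) (n m : nat) (w : 'I_n -> R) (d : 'I_m -> R).
Hypothesis m_gt0 : (0 < m)%N.
Variable s1 : state R.
Hypothesis prep : prepared alpha w d s1.
Implicit Types s st : state R.

Local Notation M := (nmem s1 count_arr).
Local Notation dig := (digit n M).
Local Notation prev := (previous n M).
Local Notation step := (step_cost w (pos_of s1) (rmem s1 type_delay_arr)).

Record ready c s : Prop := Ready {
  ready_cell : nmem s cell_arr 0%N = c;
  ready_prefix : nmem s prefix_var 0%N = (c %% n.+1)%N;
  ready_digit : forall t, (t < alpha)%N -> nmem s digit_arr t = dig t c;
  ready_size : nmem s size_arr = nmem s1 size_arr;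
  ready_count : nmem s count_arr = M;
  ready_stride : nmem s stride_arr = nmem s1 stride_arr;
  ready_prefix_size : rmem s prefix_size_arr = rmem s1 prefix_size_arr;
  ready_prefix_weight : rmem s prefix_weight_arr = rmem s1 prefix_weight_arr;
  ready_delay : rmem s type_delay_arr = rmem s1 type_delay_arr
}.

Lemma ready_same c s st : ready c s ->
  (forall b, b \in [:: cell_arr; prefix_var; digit_arr; size_arr; count_arr;
                stride_arr] ->
     nmem st b = nmem s b) ->
  (forall b, b \in [:: prefix_size_arr; prefix_weight_arr; type_delay_arr] ->
     rmem st b = rmem s b) -> ready c st.
Proof.
case=> h1 h2 h3 h4 h5 h6 h7 h8 h9 En Er.
by split; rewrite ?[rmem st _]Er ?[nmem st _]En.
Qed.

Definition valid s c t i : Prop :=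
  [/\ (t < alpha)%N, (0 < dig t c)%N, (i <= c %% n.+1)%N &
      (0 < nmem s feasible_arr (prev t i c))%N].

Definition value s c t i : R := rmem s table_arr (prev t i c) + step t i c.

(** [proc] marks the options tried so far. Either none of them was valid and cell [c] is untouched,
    or the cell holds their least value with a choice attaining it. Options only read cells other
    than [c], so they keep their values while [c] is overwritten. *)
Record scanned c s (proc : nat -> nat -> bool) st : Prop := Scanned {
  scanned_other : forall j, j != c ->
    [/\ nmem st feasible_arr j = nmem s feasible_arr j,
        rmem st table_arr j = rmem s table_arr j,
        nmem st type_choice_arr j = nmem s type_choice_arr j &
        nmem st prefix_choice_arr j = nmem s prefix_choice_arr j];
  scanned_cell :
    [/\ nmem st feasible_arr c = nmem s feasible_arr c,
        rmem st table_arr c = rmem s table_arr c &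
        forall t i, proc t i -> ~ valid s c t i] \/
    [/\ nmem st feasible_arr c = 1%N,
        valid s c (nmem st type_choice_arr c) (nmem st prefix_choice_arr c),
        rmem st table_arr c =
          value s c (nmem st type_choice_arr c) (nmem st prefix_choice_arr c) &
        forall t i, proc t i -> valid s c t i -> rmem st table_arr c <= value s c t i]
}.

Lemma prev_neq t i c : (0 < dig t c)%N -> prev t i c != c.
Proof. by move=> /(@previous_lt n M t i c) ?; rewrite ltn_eqF. Qed.

Lemma scanned_step c s (proc proc' : nat -> nat -> bool) st t i : ready c st ->
  nmem st t_var 0%N = t -> nmem st y_var 0%N = i -> (t < alpha)%N ->
  (c != 0%N -> nmem s feasible_arr c = 0%N) ->
  scanned c s proc st ->
  (forall t' i', proc' t' i' -> proc t' i' \/ (t' = t /\ i' = i)) ->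
  scanned c s proc' (after option_test st).
Proof.
move=> [rc rp rd _ _ rs rps rpw rdl] Et Ei t_lt feas0 [other cell] procP.
have stE := prepared_stride prep (ltnW t_lt).
rewrite /option_test after_if /= rc rp Et Ei rs stE -/(prev t i c) rd //.
have [/and3P[dig_gt0 i_le feas_prev]|not_valid] := ifPn; last first.
  split=> //; case: cell => [[e1 e2 none]|[e1 e2 e3 best]]; [left|right]; split=> //.
    move=> t' i' /procP[/none //|[-> ->] [_ v1 v2 v3]].
    have [e4 _ _ _] := other _ (prev_neq i v1).
    by move: not_valid; rewrite v1 v2 e4 v3.
  move=> t' i' /procP[/best //|[-> ->] [_ v1 v2 v3]].
  have [e4 _ _ _] := other _ (prev_neq i v1).
  by move: not_valid; rewrite v1 v2 e4 v3.
have [e4 e5 _ _] := other _ (prev_neq i dig_gt0).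
have v : valid s c t i by split=> //; rewrite -e4.
(* All digits of cell 0 vanish, so its preset mark is never taken for the result of an earlier
   option. *)
have c_neq0 : c != 0%N by apply: contraTneq dig_gt0 => ->; rewrite digit0.
have n_ge : (c %% n.+1 <= n)%N by rewrite -ltnS ltn_mod.
have optE : reval st option_exp = value s c t i.
  rewrite /= rc rp Et Ei rs stE -/(prev t i c) e5 rps rpw rdl /value /step_cost.
  by rewrite !(prepared_prefix_size prep) ?(prepared_prefix_weight prep)
    ?(leq_trans i_le).
have testE : beval st (BAnd (NLe (NLit 1) (NGet feasible_arr (nvar cell_arr)))
    (RLe (RGet table_arr (nvar cell_arr)) option_exp)) =
    (0 < nmem st feasible_arr c)%N && (rmem st table_arr c <= value s c t i).
  by rewrite -optE -rc.
have setE : after (RSet table_arr (nvar cell_arr) option_exp) st =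
    rset table_arr c (value s c t i) st by rewrite -optE -rc.
rewrite after_if testE.
case: ifP => [/andP[f1 le_opt]|not_better].
  split=> //; case: cell => [[e1 e2 none]|[e1 e2 e3 best]].
    by move: f1; rewrite e1 feas0.
  right; split=> // t' i' /procP[/best //|[-> ->] _].
  exact: le_opt.
rewrite !after_seq setE /after /= /upd /= rc Et Ei; split.
  by move=> j /negPf jc; rewrite /= /upd /= jc; apply: other; rewrite jc.
right; rewrite /= /upd /= eqxx; split=> // t' i' /procP[p|[-> ->] //] v'.
case: cell => [[e1 e2 none]|[e1 e2 e3 best]]; first by case: (none t' i').
apply: le_trans (best t' i' p v'); rewrite ltW // ltNge.
by move: not_better; rewrite e1 /= => ->.
Qed.

(** Invalid options may be added to [proc] freely, which leads from the bounded ranges of the loops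
    to all pairs. *)
Lemma scanned_weaken c s (proc proc' : nat -> nat -> bool) st :
  scanned c s proc st ->
  (forall t i, proc' t i -> valid s c t i -> proc t i) -> scanned c s proc' st.
Proof.
case=> other cell sub; split=> //; case: cell => [[e1 e2 none]|[e1 e2 e3 best]].
  by left; split=> // t i p v; apply: (none t i) => //; apply: sub.
by right; split=> // t i p v; apply: best => //; apply: sub.
Qed.

Lemma scanned_row c s st t : ready c st -> nmem st t_var 0%N = t ->
  (t < alpha)%N -> (c != 0%N -> nmem s feasible_arr c = 0%N) ->
  scanned c s (fun t' _ => t' < t)%N st ->
  scanned c s (fun t' _ => t' < t.+1)%N (after scan_prefixes st).
Proof.
move=> rst Et t_lt feas0 sc.
pose P k := scanned c s (fun t' i' => (t' < t) || ((t' == t) && (i' < k)))%N.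
have: P (neval st (succ_exp tasks_exp)) (after scan_prefixes st).
  apply: (for_ind (P := P)) => [|k st' _ [fn fr] Pk].
    by apply: scanned_weaken sc _ => t' i; rewrite ltn0 andbF orbF.
  have rst' : ready c (nset y_var 0%N k st').
    apply: ready_same rst _ _ => b; rewrite !inE.
      move=> bP; rewrite /= upd_neq ?fn //; last by case/or4P: bP => [|||/or3P[]] /eqP ->.
      by case/or4P: bP => [|||/or3P[]] /eqP ->.
    by move=> bP; rewrite /= fr //; case/or3P: bP => /eqP ->.
  have {}Pk : scanned c s (fun t' i' => (t' < t) || ((t' == t) && (i' < k)))%N
      (nset y_var 0%N k st') by case: Pk => other cell; split.
  apply: (scanned_step rst' _ _ t_lt feas0 Pk).
  - by rewrite /= upd_neq // fn.
  - by rewrite /= /upd.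
  by move=> t' i' /=; rewrite ltnS [(i' <= k)%N]leq_eqVlt; lia.
move/scanned_weaken; apply=> t' i /=; rewrite ltnS leq_eqVlt.
case/orP=> [/eqP ->|-> //] [_ _ i_le _].
by rewrite eqxx (ready_size rst) (prepared_n prep) addn1
  (leq_ltn_trans i_le) ?ltn_mod ?orbT.
Qed.

Lemma after_scan_options c s : ready c s ->
  (c != 0%N -> nmem s feasible_arr c = 0%N) ->
  scanned c s (fun _ _ => true) (after scan_options s).
Proof.
move=> rs feas0; pose P k := scanned c s (fun t' _ => t' < k)%N.
have: P alpha (after scan_options s).
  rewrite -[X in P X]/(neval s (NLit alpha)); apply: (for_ind (P := P)).
    split; first by [].
    left; split=> // t i; by rewrite ltn0.
  move=> k st k_lt [fn fr] Pk.
  have rst : ready c (nset t_var 0%N k st).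
    apply: ready_same rs _ _ => b; rewrite !inE.
      move=> bP; rewrite /= upd_neq ?fn //; last by case/or4P: bP => [|||/or3P[]] /eqP ->.
      by case/or4P: bP => [|||/or3P[]] /eqP ->.
    by move=> bP; rewrite /= fr //; case/or3P: bP => /eqP ->.
  apply: scanned_row rst _ k_lt feas0 _ => //.
  by case: Pk => other cell; split.
by move/scanned_weaken; apply=> t i _ [].
Qed.

Lemma after_advance c st : ready c st ->
  nmem (after advance st) prefix_var 0%N = (c.+1 %% n.+1)%N /\
  forall t, (t < alpha)%N -> nmem (after advance st) digit_arr t = dig t c.+1.
Proof.
case=> _ rp rd rn rM _ _ _ _; rewrite /advance after_seq.
set st1 := after prefix_step st.
have [fn1 _] : framed prefix_step st st1 by exact: frame.
have [pE cE] : nmem st1 prefix_var 0%N = (c.+1 %% n.+1)%N /\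
    nmem st1 carry_var 0%N = (stride n M 0 %| c.+1)%N.
  rewrite /st1 /prefix_step after_seq after_if /= /upd /= rp rn (prepared_n prep).
  rewrite modnS_if dvdnS_mod addn1.
  by case: ifP => _; rewrite /after /= /upd /= ?rp ?addn1.
set st2 := after _ st1.
have [fn2 _] : framed (For t_var (NLit alpha) carry_step) st1 st2 by exact: frame.
split; first by rewrite fn2.
(* Before round [k] the flag is the carry into digit [k], and just the digits below [k] are those of
   [c + 1]. *)
pose P k st' := nmem st' carry_var 0%N = (stride n M k %| c.+1)%N /\
  forall t, (t < alpha)%N ->
    nmem st' digit_arr t = if (t < k)%N then dig t c.+1 else dig t c.
suff [_ dE] : P alpha st2 by move=> t t_lt; rewrite dE // t_lt.
rewrite /st2 -[X in P X]/(neval st1 (NLit alpha)); apply: (for_ind (P := P)).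
  by split=> // t t_lt; rewrite fn1 //= rd.
move=> k st' k_lt [fn fr] [cE' dE'].
have M' : nmem st' count_arr = M by rewrite fn // fn1.
rewrite /P after_if /= /upd /= cE' stride_dvd_next.
have := dE' k k_lt; rewrite ltnn => dk.
have [dvd|ndvd] := boolP (stride n M k %| c.+1)%N; last first.
  rewrite /= /after /= /upd /= cE' (negPf ndvd); split=> // t t_lt.
  rewrite dE' // ltnS [(t <= k)%N]leq_eqVlt; case: eqP => [->|//].
  by rewrite ltnn /= digitS (negPf ndvd).
rewrite /= after_if /= /upd /= dk M' addn1.
have tE t : (if (t < k.+1)%N then dig t c.+1 else dig t c) =
    if t == k then (if (dig k c < M k)%N then (dig k c).+1 else 0%N)
    else if (t < k)%N then dig t c.+1 else dig t c.
  rewrite ltnS [(t <= k)%N]leq_eqVlt; case: eqP => [->|//].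
  by rewrite /= digitS dvd.
case: ifP => dM; rewrite /after /= /upd /= ?dk ?cE' ?dvd; split=> // t t_lt;
  by rewrite tE dM dE' // ?addn1.
Qed.

Local Notation tasks := (cell_tasks (@pos_of R n s1)).
Local Notation resources := (cell_resources n M (@type_of R m s1) (@num_of R m s1)).

(** Besides the lowest cost, a feasible cell other than 0 records a valid option attaining it; the
    readout follows these choices. *)
Definition cell_ok st c : Prop :=
  if nmem st feasible_arr c == 0%N
  then forall A : assignment n m, ~ assigns (tasks c) (resources c) A
  else is_lowest_cost w d (tasks c) (resources c) (rmem st table_arr c) /\
    (c != 0%N ->
       valid st c (nmem st type_choice_arr c) (nmem st prefix_choice_arr c) /\
       rmem st table_arr c =
         value st c (nmem st type_choice_arr c) (nmem st prefix_choice_arr c)).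

(** The recorded option refers to an earlier cell, so agreement up to [c] is enough. *)
Lemma same_cell_ok st st' c :
  (forall j, (j <= c)%N ->
    [/\ nmem st' feasible_arr j = nmem st feasible_arr j,
        rmem st' table_arr j = rmem st table_arr j,
        nmem st' type_choice_arr j = nmem st type_choice_arr j &
        nmem st' prefix_choice_arr j = nmem st prefix_choice_arr j]) ->
  cell_ok st c -> cell_ok st' c.
Proof.
move=> same; have [e1 e2 e3 e4] := same c (leqnn c).
rewrite /cell_ok e1 e2 e3 e4; case: ifP => // _ [low choice]; split=> // c0.
have [[v1 v2 v3 v4] tE] := choice c0.
have [e5 e6 _ _] := same _ (ltnW (previous_lt (nmem st prefix_choice_arr c) v2)).
by rewrite /valid /value e5 e6.
Qed.

Record filled k st : Prop := Filled {
  filled_frame : framed fill_cmd s1 st;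
  filled_prefix : nmem st prefix_var 0%N = (k %% n.+1)%N;
  filled_digit : forall t, (t < alpha)%N -> nmem st digit_arr t = dig t k;
  filled_cell : forall c, (c < k)%N -> cell_ok st c;
  filled_empty : forall c, (k <= c)%N ->
    nmem st feasible_arr c = (c == 0%N) /\ rmem st table_arr c = 0
}.

Lemma filled0 : filled 0 s1.
Proof.
split=> //.
- by rewrite mod0n (prepared_prefix prep).
- by move=> t _; rewrite digit0 (prepared_digit prep).
- by move=> c _; rewrite (prepared_feasible prep) (prepared_table prep).
Qed.

Lemma filled_ready k st : filled k st -> ready k (nset cell_arr 0%N k st).
Proof.
by case=> [[fn fr] fp fd _ _]; split=> //=; rewrite ?upd_neq ?fn ?fr.
Qed.

Lemma scanned_cell_ok k st st' : filled k st -> (k < stride n M alpha)%N ->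
  scanned k (nset cell_arr 0%N k st) (fun _ _ => true) st' -> cell_ok st' k.
Proof.
case=> [_ _ _ ok empty] k_lt [other cell].
have {other} other j : j != k -> [/\ nmem st' feasible_arr j = nmem st feasible_arr j,
        rmem st' table_arr j = rmem st table_arr j,
        nmem st' type_choice_arr j = nmem st type_choice_arr j &
        nmem st' prefix_choice_arr j = nmem st prefix_choice_arr j] by apply: other.
have [feas0 table0] := empty k (leqnn k).
(* Induction on the cell number: the earlier cell is feasible because [B] exists, and its entry is a
   lower bound. *)
have lower t i (B : assignment n m) : (t < alpha)%N -> (0 < dig t k)%N ->
    (i <= k %% n.+1)%N ->
    assigns (tasks (prev t i k)) (resources (prev t i k)) B ->
    valid st k t i /\
    rmem st table_arr (prev t i k) <= sub_cost w d (tasks (prev t i k)) B.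
  move=> t_lt dig_gt0 i_le asB; have := ok _ (previous_lt i dig_gt0).
  rewrite /cell_ok; case: eqP => [_ /(_ B)//|/eqP f1 [[_ low] _]].
  by split; [split=> //; rewrite lt0n | apply: low].
have best (A : assignment n m) : k != 0%N -> assigns (tasks k) (resources k) A ->
    exists t i, valid st k t i /\ value st k t i <= sub_cost w d (tasks k) A.
  move=> k0 asA.
  have [t [i [B [t_lt dig_gt0 i_le asB le_cost]]]] :=
    best_option (prepared_pos_inj prep) (prepared_pos_lt prep)
      (prepared_pos_weight prep) (prepared_type_lt prep)
      (prepared_resource_ex prep) (prepared_resource_inj prep)
      (prepared_delay prep) k0 k_lt asA.
  have [v low] := lower t i B t_lt dig_gt0 i_le asB; exists t, i; split=> //.
  by apply: le_trans le_cost; rewrite lerD2r.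
rewrite /cell_ok; case: cell => [[e1 e2 none]|[e1 v e2 least]].
  rewrite e1 e2 /= /upd /= feas0 table0.
  (* When no option is valid, [best] excludes every assignment unless the cell is 0, the base
     case. *)
  have [->|k0] /= := eqVneq k 0%N; last first.
    by move=> A /(best A k0) [t [i [v _]]]; apply: (none t i).
  split=> //; have t0 : tasks 0 = set0.
    by apply/setP => x; rewrite !inE mod0n.
  have cost0 A : sub_cost w d set0 A = 0 by rewrite /sub_cost big_set0.
  rewrite t0; split; last by move=> A _; rewrite cost0.
  by exists [ffun => Ordinal m_gt0]; rewrite ?cost0 // => x; rewrite inE.
rewrite e1 /=; have k0 : k != 0%N.
  by case: v => _ + _ _; apply: contraTneq => ->; rewrite digit0.
set t := nmem st' type_choice_arr k in v e2 *.
set i := nmem st' prefix_choice_arr k in v e2 *.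
have [t_lt dig_gt0 i_le f1] := v.
split; last first.
  move=> _; have [e3 e4 _ _] := other _ (prev_neq i dig_gt0).
  by rewrite /valid /value e3 e4.
split.
  (* Attainment: an optimal assignment of the chosen earlier cell, extended by the segment on
     [r]. *)
  have := ok _ (previous_lt i dig_gt0); rewrite /cell_ok.
  case: eqP => [f0|_ [[[A asA costA] _] _]]; first by move: f1; rewrite /= /upd /= f0.
  have [|r tyr numr] := prepared_resource_ex prep (k := (dig t k).-1) t_lt.
    by rewrite prednK // digit_le.
  have [asE costE] := extend_option w (prepared_resource_inj prep)
    (prepared_delay prep) dig_gt0 i_le tyr numr asA.
  by exists (extend (pos_of s1) i r A) => //; rewrite costE e2 costA.
move=> A /(best A k0) [t' [i' [v' le_A]]]; apply: le_trans le_A.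
exact: (least t' i').
Qed.

Lemma filledS k st : filled k st -> (k < stride n M alpha)%N ->
  filled k.+1 (after entry_cmd (nset cell_arr 0%N k st)).
Proof.
move=> fil k_lt; have rdy := filled_ready fil.
set s := nset cell_arr 0%N k st; have [fr fp fd ok empty] := fil.
have [f0 t0] := empty k (leqnn k).
have sc : scanned k s (fun _ _ => true) (after scan_options s).
  by apply: after_scan_options rdy _ => k0; rewrite /= /upd /= f0 (negPf k0).
have okk := scanned_cell_ok fil k_lt sc.
have [other _] := sc; rewrite /entry_cmd after_seq.
set st1 := after scan_options s in sc okk other *.
have [fn1 fr1] : framed scan_options s st1 by exact: frame.
have rdy1 : ready k st1.
  apply: ready_same rdy _ _ => b; rewrite !inE.
    by move=> bP; rewrite fn1 //; case/or4P: bP => [|||/or3P[]] /eqP ->.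
  by move=> bP; rewrite fr1 //; case/or3P: bP => /eqP ->.
have [fn2 fr2] := frame advance st1.
have [pE dE] := after_advance rdy1.
split=> //.
- split=> b bP.
    have b2 : b \notin nmods advance.
      by apply: contra bP; rewrite /= !inE;
        do ![case/orP=> [->|]; rewrite ?orbT //]; move=> ->; rewrite ?orbT.
    have b1 : b \notin nmods scan_options.
      by apply: contra bP; rewrite /= !inE;
        do ![case/orP=> [->|]; rewrite ?orbT //]; move=> ->; rewrite ?orbT.
    rewrite fn2 // fn1 // /s /= upd_neq ?(fr.1 _ bP) //.
    by apply: contraNneq bP => ->.
  by rewrite fr2 // fr1 //; apply: fr.2.
- move=> c; rewrite ltnS leq_eqVlt => /orP[/eqP ->|c_lt].
    by apply: same_cell_ok okk => j _; rewrite !fn2 ?fr2.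
  apply: same_cell_ok (ok c c_lt) => j jc; rewrite !fn2 ?fr2 //.
  by apply: other; rewrite ltn_eqF // (leq_ltn_trans jc).
move=> c kc; rewrite !fn2 ?fr2 //.
have [|-> -> _ _] := other c; first by rewrite gtn_eqF.
by apply: empty; apply: ltnW.
Qed.

Lemma entry_other k st j : filled k st -> j != k ->
  rmem (after entry_cmd (nset cell_arr 0%N k st)) table_arr j =
  rmem st table_arr j.
Proof.
move=> fil jk; have [_ _ _ _ /(_ k (leqnn k)) [f0 _]] := fil.
rewrite /entry_cmd after_seq (frame advance _).2 //.
have [|other _] := after_scan_options (filled_ready fil).
  by move=> k0; rewrite /= /upd /= f0 (negPf k0).
by have [_ -> _ _] := other j jk.
Qed.

End Entry.

(** * Reading out an assignment *)

Definition place_test : cmd :=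
  let y := nvar y_var in
  If (BAnd (NLe (nvar low_var) (NGet pos_arr y))
           (NLe (succ_exp (NGet pos_arr y)) (nvar prefix_var)))
     (NSet out_arr y (nvar slot_var)) Skip.

Definition place_tasks : cmd := For y_var tasks_exp place_test.

(** Pops a resource of the chosen type from its stack, gives it the segment between the chosen and
    the current prefix, and moves to the earlier cell. *)
Definition walk_step : cmd :=
  let t := nvar t_var in let c := nvar cell_arr in
  Seq (NSet t_var (NLit 0) (NGet type_choice_arr c))
 (Seq (NSet low_var (NLit 0) (NGet prefix_choice_arr c))
 (Seq (NSet slot_var (NLit 0) (NGet last_arr t))
 (Seq (NSet last_arr t (NGet link_arr (nvar slot_var)))
 (Seq place_tasks
 (Seq (NSet cell_arr (NLit 0) (previous_exp t (nvar low_var)))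
      (NSet prefix_var (NLit 0) (nvar low_var))))))).

(** Each active round uses up one resource, so cell 0 is reached within [m] rounds; the remaining
    rounds are idle. *)
Definition walk : cmd :=
  For x_var resources_exp (If (NLe (NLit 1) (nvar cell_arr)) walk_step Skip).

Section Readout.
Variable alpha : nat.

Definition readout_cmd : cmd :=
  Seq (NSet cell_arr (NLit 0) (NSub (entries_exp alpha) (NLit 1)))
 (Seq (NSet prefix_var (NLit 0) tasks_exp) walk).

Variables (R : realType) (n m : nat) (w : 'I_n -> R) (d : 'I_m -> R).
Hypothesis m_gt0 : (0 < m)%N.
Variables s1 st0 : state R.
Hypothesis prep : prepared alpha w d s1.
Implicit Types s st : state R.

Local Notation M := (nmem s1 count_arr).
Local Notation dig := (digit n M).
Local Notation prev := (previous n M).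
Local Notation pos := (@pos_of R n s1).
Local Notation ty := (@type_of R m s1).
Local Notation num := (@num_of R m s1).
Local Notation tasks := (cell_tasks pos).
Local Notation resources := (cell_resources n M ty num).
Local Notation total := (stride n M alpha).

Hypothesis fil : filled alpha w d s1 total st0.

Let st0E b : b \notin nmods (fill_cmd alpha) -> nmem st0 b = nmem s1 b.
Proof. by have [[fn _] _ _ _ _] := fil; apply: fn. Qed.

Lemma after_place s x : (x < n)%N -> nmem s size_arr 0%N = n ->
  nmem (after place_tasks s) out_arr x =
  if (nmem s low_var 0 <= nmem s pos_arr x < nmem s prefix_var 0)%N
  then nmem s slot_var 0%N else nmem s out_arr x.
Proof.
move=> xn En.
pose P k st := forall j, nmem st out_arr j =
  if (j < k)%N && (nmem s low_var 0 <= nmem s pos_arr j < nmem s prefix_var 0)%N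
  then nmem s slot_var 0%N else nmem s out_arr j.
suff /(_ x) : P n (after place_tasks s) by rewrite xn.
rewrite -{1}En; apply: (for_ind (P := P)) => [j|k st _ [fn _] Pk j] //.
rewrite after_if /= /upd /= !fn // addn1 ltnS [(j <= k)%N]leq_eqVlt.
case: ifP => test; rewrite /after /= /upd /= ?(fn slot_var isT) Pk.
  by case: eqP => [->|//]; rewrite test.
by case: eqP => [->|//]; rewrite test ltnn.
Qed.

Lemma full_tasks : tasks total.-1 = [set: 'I_n].
Proof.
by apply/setP => x; rewrite !inE mod_last; apply: prepared_pos_lt prep x.
Qed.

Lemma full_resources : resources total.-1 = [set: 'I_m].
Proof.
apply/setP => r; rewrite !inE digit_last ?(prepared_type_lt prep) //.
exact: prepared_num_lt prep r.
Qed.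

Let cell_of c : (c < total)%N -> cell_ok alpha w d s1 st0 c.
Proof. by move=> c_lt; have [_ _ _ ok _] := fil; apply: ok. Qed.

Let last_lt : (total.-1 < total)%N.
Proof. by rewrite prednK ?stride_gt0. Qed.

Lemma full_cell : nmem st0 feasible_arr total.-1 != 0%N /\
  is_lowest_cost w d [set: 'I_n] [set: 'I_m] (rmem st0 table_arr total.-1).
Proof.
have := cell_of last_lt; rewrite /cell_ok full_tasks full_resources.
case: eqP => // [_ /(_ [ffun => Ordinal m_gt0])|_ [low _]]; last by split.
by case=> x _; rewrite inE.
Qed.

Definition merge i (A B : assignment n m) : assignment n m :=
  [ffun x => if (pos x < i)%N then A x else B x].

(** After [k] resources have been read out, cell [c] remains to be read. *)
Record walked k st c : Prop := Walked {
  walked_cell : nmem st cell_arr 0%N = c;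
  walked_prefix : nmem st prefix_var 0%N = (c %% n.+1)%N;
  walked_lt : (c < total)%N;
  walked_feasible : nmem st0 feasible_arr c != 0%N;
  walked_last : forall t, (t < alpha)%N -> (0 < dig t c)%N -> exists r : 'I_m,
    [/\ nmem st last_arr t = r, ty r = t & num r = (dig t c).-1];
  walked_card : c = 0%N \/ (#|resources c| + k <= m)%N;
  walked_out : exists B : assignment n m,
    (forall x : 'I_n, (c %% n.+1 <= pos x)%N -> nmem st out_arr x = B x) /\
    (forall A, assigns (tasks c) (resources c) A ->
       sub_cost w d (tasks c) A = rmem st0 table_arr c ->
       social_cost w d (merge (c %% n.+1) A B) = rmem st0 table_arr total.-1)
}.

Lemma walked0 st : nmem st cell_arr 0%N = total.-1 ->
  nmem st prefix_var 0%N = n -> nmem st last_arr = nmem s1 last_arr ->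
  walked 0 st total.-1.
Proof.
move=> Ec Ep El; split=> //.
- by rewrite mod_last.
- by have [] := full_cell.
- move=> t t_lt; rewrite digit_last // El; exact: (prepared_last prep).
- by right; rewrite addn0 full_resources cardsT card_ord.
exists [ffun => Ordinal m_gt0]; rewrite mod_last; split=> [x|A _].
  by rewrite leqNgt (prepared_pos_lt prep).
rewrite full_tasks social_costE => <-; apply: eq_sub_cost => x _.
by rewrite ffunE (prepared_pos_lt prep).
Qed.

Let choice c : (c < total)%N -> nmem st0 feasible_arr c != 0%N -> c != 0%N ->
  exists t i, [/\ nmem st0 type_choice_arr c = t, nmem st0 prefix_choice_arr c = i,
    valid alpha n s1 st0 c t i &
    rmem st0 table_arr c = value w s1 st0 c t i].
Proof.
move=> /cell_of + f0 c0; rewrite /cell_ok (negPf f0) => -[_ /(_ c0) [v tE]].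
by exists (nmem st0 type_choice_arr c), (nmem st0 prefix_choice_arr c).
Qed.

(** An optimal assignment of the earlier cell, extended by the segment just placed, attains the
    entry of [c]. What was known about completing optimal assignments of [c] thus passes to the
    earlier cell. *)
Lemma walked_step k st c : walked k st c -> c != 0%N ->
  (forall b, b \in [:: size_arr; pos_arr; link_arr; stride_arr] ->
     nmem st b = nmem s1 b) ->
  (forall b, b \in [:: type_choice_arr; prefix_choice_arr] -> nmem st b = nmem st0 b) ->
  exists c', walked k.+1 (after walk_step st) c'.
Proof.
case=> Ec Ep c_lt feas Elast card [B [outB costB]] c0 same1 same0.
have [t [i [Et Ei [t_lt dig_gt0 i_le fprev] tabE]]] := choice c_lt feas c0.
have [r [lastE tyr numr]] := Elast t t_lt dig_gt0.
exists (prev t i c); rewrite /walk_step !after_seq.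
set sa := after (NSet last_arr _ _) _.
have [saN saL] : (forall b, b \notin [:: t_var; low_var; slot_var; last_arr] ->
      nmem sa b = nmem st b) /\
    [/\ nmem sa t_var 0%N = t, nmem sa low_var 0%N = i,
     nmem sa slot_var 0%N = r &
     forall u, nmem sa last_arr u =
       if u == t then nmem s1 link_arr r else nmem st last_arr u].
  have e17 := same0 type_choice_arr isT; have e18 := same0 prefix_choice_arr isT.
  rewrite /sa /after /= /upd /= Ec e17 e18 Et Ei lastE (same1 link_arr isT); split=> // b.
  by rewrite !inE !negb_or => /and4P[/negPf -> /negPf -> /negPf -> /negPf ->].
have [sat sal sas saX] := saL.
set sb := after place_tasks sa.
have [sbN _] : framed place_tasks sa sb by exact: frame.
have sbE b : b \notin [:: t_var; low_var; slot_var; last_arr; y_var; out_arr] ->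
    nmem sb b = nmem st b.
  rewrite !inE !negb_or => /and5P[b1 b2 b3 b4 /andP[b5 b6]].
  by rewrite sbN ?saN // !inE !negb_or ?b1 ?b2 ?b3 ?b4 ?b5 ?b6.
have prevE : prev t i c = (c - nmem s1 stride_arr t - (c %% n.+1 - i))%N.
  by rewrite (prepared_stride prep) // ltnW.
rewrite /after /= /upd /= (sbE 2%N) // Ec (sbN t_var) // sat (sbE stride_arr) // same1 //.
rewrite (sbE prefix_var) // Ep (sbN low_var) // sal -prevE.
split; rewrite /= /upd //=.
- by rewrite previous_mod.
- exact: ltn_trans (previous_lt i dig_gt0) c_lt.
- by rewrite -lt0n.
- move=> u u_lt; rewrite digit_previous // sbN // saX.
  case: eqP => [->|_]; last by rewrite subn0; apply: Elast.
  rewrite subn1 => d1; have [|r' [h1 h2 h3]] := prepared_link prep (r := r).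
    by rewrite numr.
  by exists r'; rewrite h1 h2 h3 numr.
- right; rewrite (cell_resources_previous (prepared_resource_inj prep)
    dig_gt0 i_le tyr numr).
  have rQ := mem_cell_resources dig_gt0 tyr numr.
  by case: card => [/eqP|]; rewrite ?(negPf c0) // (cardsD1 r) rQ addnS.
exists [ffun x => if (i <= pos x < c %% n.+1)%N then r else B x].
rewrite previous_mod //; split=> [x i_x|A asA costA].
  rewrite after_place ?ltn_ord //; last by rewrite saN // same1 // (prepared_n prep).
  rewrite sal sas !saN // same1 // Ep ffunE i_x; case: ifP => //= /negbT.
  by rewrite -leqNgt; apply: outB.
have [asE costE] := extend_option w (prepared_resource_inj prep)
    (prepared_delay prep) dig_gt0 i_le tyr numr asA.
rewrite -(costB _ asE); last by rewrite costE costA tabE.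
congr social_cost; apply/ffunP => x; rewrite !ffunE.
case: (ltnP (pos x) i) => [x_i|_] /=; first by rewrite (leq_trans x_i).
by case: ifP.
Qed.

Lemma after_readout : exists2 A : assignment n m,
  outputs (after readout_cmd st0) A & optimal w d A.
Proof.
have [_ [_ low]] := full_cell.
rewrite /readout_cmd !after_seq; set st := after (NSet prefix_var _ _) _.
have stN b : b \notin [:: cell_arr; prefix_var] -> nmem st b = nmem st0 b.
  by rewrite !inE negb_or => /andP[b1 b2]; rewrite /st /= !upd_neq.
pose P k st' := exists c, walked k st' c.
have : P m (after walk st).
  have <- : neval st resources_exp = m.
    by rewrite /st /after /= /upd /= st0E // (prepared_m prep).
  apply: (for_ind (P := P)).
    exists total.-1; apply: walked0.
    - by rewrite /st /after /= /upd /= st0E // (prepared_stride prep) // subn1.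
    - by rewrite /st /after /= /upd /= st0E // (prepared_n prep).
    by rewrite /st /= upd_neq // upd_neq // st0E.
  move=> k st' _ [fn _] [c wc].
  have {}wc : walked k (nset x_var 0%N k st') c by case: wc => *; split.
  rewrite /P after_if; have -> :
    beval (nset x_var 0%N k st') (NLe (NLit 1) (nvar cell_arr)) = (c != 0%N).
    by rewrite -(walked_cell wc) -lt0n.
  case: ifP => [c0|/negbT/negPn/eqP c0].
    apply: walked_step wc c0 _ _ => b; rewrite !inE.
      by case/or4P=> /eqP -> /=; rewrite upd_neq // fn // stN // st0E.
    by case/orP=> /eqP -> /=; rewrite upd_neq // fn // stN.
  by exists c; case: wc => *; split=> //; left.
move=> [c [_ _ c_lt feas _ card [B [outB costB]]]].
(* After [m] rounds either the cell is 0 or no resource is left; a nonzero feasible cell would still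
   have a choice, which needs a resource. *)
have c0 : c = 0%N.
  case: card => //; rewrite -[X in (_ <= X)%N]add0n leq_add2r leqn0 cards_eq0 => /eqP Q0.
  apply/eqP/negPn/negP => c0.
  have [t [i [_ _ [t_lt dig_gt0 _ _] _]]] := choice c_lt feas c0.
  have [|r tyr numr] := prepared_resource_ex prep (k := (dig t c).-1) t_lt.
    by rewrite prednK // digit_le.
  by have := mem_cell_resources dig_gt0 tyr numr; rewrite Q0 inE.
rewrite c0 mod0n in outB costB feas.
exists B; first by move=> x; apply: outB.
have tasks0 : tasks 0 = set0 by apply/setP => x; rewrite !inE mod0n.
have cost0 A : sub_cost w d (tasks 0) A = 0 by rewrite tasks0 /sub_cost big_set0.
have table0 : rmem st0 table_arr 0%N = 0.
  have := cell_of (stride_gt0 n M alpha); rewrite /cell_ok (negPf feas).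
  by case=> [[[A _ <-] _] _].
have mergeB : merge 0 B B = B by apply/ffunP => x; rewrite ffunE.
have costE : social_cost w d B = rmem st0 table_arr total.-1.
  rewrite -mergeB; apply: costB; last by rewrite cost0 table0.
  by move=> x; rewrite tasks0 inE.
move=> A; rewrite costE.
by rewrite social_costE; apply: low => x _; rewrite inE.
Qed.

End Readout.

(** * The dynamic program *)

Section Times.
Variables (R : realType) (alpha n m : nat) (s : state R).
Hypotheses (n_gt0 : (0 < n)%N) (m_gt0 : (0 < m)%N).
Hypotheses (En : nmem s size_arr 0%N = n) (Em : nmem s size_arr 1%N = m).

(** The factor 1000 is a generous round figure above the coefficients of the static bound; [n > 0]
    absorbs the [n + 1] candidate prefixes. *)
Lemma time_entry (st : state R) : nmem st size_arr = nmem s size_arr ->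
  (time (entry_cmd alpha) st <= 1000 * alpha.+1 * n)%N.
Proof.
move=> /(@time_le _ (entry_cmd alpha) s st isT)/leq_trans; apply.
by rewrite /= En; clear Em m_gt0; nia.
Qed.

Lemma time_setup : (time (setup_cmd alpha) s <= 1000 * alpha.+1 * (n * (n + m)))%N.
Proof.
apply: leq_trans (@time_le _ (setup_cmd alpha) s s isT erefl) _.
by rewrite /= En Em; nia.
Qed.

Lemma time_readout (st : state R) : nmem st size_arr = nmem s size_arr ->
  (time (readout_cmd alpha) st <= 1000 * (n * (n + m)))%N.
Proof.
move=> /(@time_le _ (readout_cmd alpha) s st isT)/leq_trans; apply.
by rewrite /= En Em; nia.
Qed.

End Times.

(** Each of the [u + 1] radices costs a factor 2, by [n + 1 <= 2 * n] and [M t + 1 <= 2 * m]. *)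
Lemma stride_le n M u m : (0 < n)%N -> (0 < m)%N -> (forall t, M t <= m)%N ->
  (stride n M u <= 2 ^ u.+1 * (n * m ^ u))%N.
Proof.
move=> n_gt0 m_gt0 M_le; elim: u => [|u IH] /=; first by rewrite expn0; lia.
apply: leq_trans (leq_mul IH (_ : (M u).+1 <= 2 * m)%N) _.
  by have := M_le u; lia.
by rewrite [(2 ^ u.+2)%N]expnS [(m ^ u.+1)%N]expnS; apply: eq_leq; ring.
Qed.

Section Program.
Variables (R : realType) (alpha n m : nat).

Definition scheduler : dynprog :=
  DynProg (setup_cmd alpha) (entries_exp alpha) (entry_cmd alpha)
    (readout_cmd alpha).

Variables (w : 'I_n -> R) (d : 'I_m -> R) (dvals : alpha.-tuple R).
Hypotheses (n_gt0 : (0 < n)%N) (m_gt0 : (0 < m)%N).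
Hypothesis d_vals : forall r, d r \in dvals.

Let s0 := input w d.
Let s1 := after (setup_cmd alpha) s0.
Let prep : prepared alpha w d s1 := after_setup w d_vals.
Let total := stride n (nmem s1 count_arr) alpha.
Let state_at k := after_entries scheduler s0 k.

Lemma table_sizeE : table_size scheduler s0 = total.
Proof. exact: (prepared_stride prep (leqnn alpha)). Qed.

Let state_atE k : state_at k =
  iteri k (fun j st => after (entry_cmd alpha) (nset cell_arr 0%N j st)) s1.
Proof. exact: (after_for cell_arr (NLit k) (entry_cmd alpha) s1). Qed.

Lemma state_atS k :
  state_at k.+1 = after (entry_cmd alpha) (nset cell_arr 0%N k (state_at k)).
Proof. by rewrite !state_atE. Qed.

Lemma filled_at k : (k <= total)%N -> filled alpha w d s1 k (state_at k).
Proof.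
elim: k => [_|k IH k_lt]; first exact: filled0.
by rewrite state_atS; apply: filledS (IH (ltnW k_lt)) k_lt.
Qed.

Lemma state_at_total : after (fill_cmd alpha) s1 = state_at total.
Proof.
rewrite state_atE /fill_cmd after_for.
by have -> : neval s1 (entries_exp alpha) = total by exact: table_sizeE.
Qed.

Lemma after_program : after (dp_cmd scheduler) s0 =
  after (readout_cmd alpha) (state_at total).
Proof.
have -> : after (dp_cmd scheduler) s0 =
    after (readout_cmd alpha) (after (fill_cmd alpha) s1) by [].
by rewrite state_at_total.
Qed.

Lemma scheduler_fills : fills_in_order scheduler s0.
Proof.
split=> [j|k j]; first exact: (prepared_table prep).
rewrite table_sizeE => k_lt jk; rewrite -!/(state_at _) state_atS.
exact: entry_other (filled_at (ltnW k_lt)) jk.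
Qed.

Lemma scheduler_tabulates : tabulates_subinstances scheduler s0 w d.
Proof.
exists (fun k => (cell_tasks (@pos_of R n s1) k,
  cell_resources n (nmem s1 count_arr) (@type_of R m s1) (@num_of R m s1) k)).
rewrite table_sizeE; split.
  exists total.-1; first by rewrite prednK ?stride_gt0.
  by rewrite (full_tasks prep) (full_resources prep).
move=> k k_lt [A asA]; have [_ _ _ ok _] := filled_at (leqnn total).
rewrite /table table_sizeE; have := ok k k_lt; rewrite /cell_ok.
by case: ifP => [_ /(_ A)//|_ []].
Qed.

Lemma scheduler_optimal : exists2 A : assignment n m,
  outputs (after (dp_cmd scheduler) s0) A & optimal w d A.
Proof. by rewrite after_program; apply: after_readout (filled_at (leqnn total)). Qed.

Lemma scheduler_table_size :
  (table_size scheduler s0 <= 2 ^ alpha.+1 * (n * m ^ alpha))%N.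
Proof. by rewrite table_sizeE; apply: stride_le => //; apply: prepared_count prep. Qed.

Let size_at k : (k <= total)%N -> nmem (state_at k) size_arr = nmem s1 size_arr.
Proof. by move=> /filled_at [[fn _] _ _ _ _]; apply: fn. Qed.

Lemma scheduler_entry_time k : (k < table_size scheduler s0)%N ->
  (entry_time scheduler s0 k <= 1000 * alpha.+1 * n)%N.
Proof.
rewrite table_sizeE => k_lt.
have := @time_entry R alpha n s1 n_gt0 (prepared_n prep)
  (nset cell_arr 0%N k (state_at k)); apply.
by rewrite -(size_at (ltnW k_lt)); apply: (upd_neq _ _ _ (b := size_arr)).
Qed.

Lemma scheduler_outer_time :
  (setup_time scheduler s0 + readout_time scheduler s0
     <= 2000 * alpha.+1 * (n * (n + m)))%N.
Proof.
have := time_setup alpha n_gt0 m_gt0 (s := s0) erefl erefl.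
have := time_readout alpha n_gt0 m_gt0 (prepared_n prep) (prepared_m prep)
  (size_at (leqnn total)).
rewrite /setup_time /readout_time table_sizeE -/(state_at total) /=; nia.
Qed.

Lemma scheduler_total_time : (0 < alpha)%N ->
  (total_time scheduler s0 <=
     (5000 * alpha.+1 + 1001 * alpha.+1 * 2 ^ alpha.+1) * (n ^ 2 * m ^ alpha))%N.
Proof.
move=> alpha_gt0; have outer : (setup_time scheduler s0 + readout_time scheduler s0
    <= 2000 * alpha.+1 * (n * (n + m)))%N := scheduler_outer_time.
have -> : total_time scheduler s0 = (setup_time scheduler s0 +
    (time (fill_cmd alpha) s1 + readout_time scheduler s0).+1).+1.
  rewrite /total_time /dp_cmd 2!time_seq /readout_time table_sizeE.
  by rewrite -/(state_at total) -state_at_total.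
(* Each round of the loop costs one unit beyond its entry; this unit turns 1000 into 1001 below. *)
have fill_le : (time (fill_cmd alpha) s1 <= 3 + total * (1000 * alpha.+1 * n).+1)%N.
  rewrite /fill_cmd time_for.
  have -> : neval s1 (entries_exp alpha) = total by exact: table_sizeE.
  rewrite leq_add2l -[X in (_ <= X * _)%N]card_ord -sum_nat_const leq_sum // => k _.
  rewrite ltnS -state_atE; apply: scheduler_entry_time.
  by rewrite table_sizeE.
have size_le := scheduler_table_size; rewrite table_sizeE in size_le.
(* Here [alpha > 0] enters: it lets the term [n * m] of the work outside the table be absorbed. *)
have m_le : (m <= m ^ alpha)%N.
  by rewrite -[X in (X <= _)%N]expn1 leq_pexp2l.
set K := (m ^ alpha)%N in m_le size_le *.
set E := (2 ^ alpha.+1)%N in size_le *.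
have {size_le} fill_le' : (time (fill_cmd alpha) s1 <=
    3 + 1001 * alpha.+1 * E * (n ^ 2 * K))%N.
  apply: leq_trans fill_le _; rewrite leq_add2l.
  apply: leq_trans (leq_mul size_le (_ : _ <= 1001 * alpha.+1 * n)%N) _.
    by nia.
  by rewrite expnS expn1; apply: eq_leq; ring.
have outer' : (2000 * alpha.+1 * (n * (n + m)) <= 4000 * alpha.+1 * (n ^ 2 * K))%N.
  suff : (n * (n + m) <= 2 * (n ^ 2 * K))%N by nia.
  have : (n + m <= 2 * (n * K))%N by nia.
  by rewrite expnS expn1; nia.
have nK : (1 <= n ^ 2 * K)%N by rewrite muln_gt0 expn_gt0 n_gt0; lia.
rewrite mulnDl; nia.
Qed.

End Program.

Theorem mainTheorem11 (R : realType) (alpha : nat) (halpha : (0 < alpha)%N) :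
  exists (D : dynprog) (c : nat),
    forall (n m : nat) (hn : (0 < n)%N) (hm : (0 < m)%N)
           (w : 'I_n -> R) (hw : forall i, 1 <= w i)
           (d : 'I_m -> R) (hd : forall r, 0 < d r)
           (dvals : alpha.-tuple R) (hdvals : uniq dvals)
           (hdd : forall r, d r \in dvals),
      let s0 := input w d in
      [/\ (* a dynamic program for the instance *)
          fills_in_order D s0 /\ tabulates_subinstances D s0 w d,
          (* finding an optimal assignment *)
          exists2 A : assignment n m,
            outputs (after (dp_cmd D) s0) A & optimal w d A,
          (* table size and time per entry *)
          (table_size D s0 <= c * (n * m ^ alpha))%N /\
          (forall k, (k < table_size D s0)%N -> (entry_time D s0 k <= c * n)%N),
          (* the work outside the table *)
          (setup_time D s0 + readout_time D s0 <= c * (n * (n + m)))%N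
        & (* total time *)
          (total_time D s0 <= c * (n ^ 2 * m ^ alpha))%N].
Proof.
(* The constant of the total time dominates those of all the other bounds. *)
exists (scheduler alpha), (5000 * alpha.+1 + 1001 * alpha.+1 * 2 ^ alpha.+1)%N.
move=> n m n_gt0 m_gt0 w _ d _ dvals _ d_vals s0.
split.
- by split; [apply: scheduler_fills d_vals | apply: scheduler_tabulates d_vals].
- exact: scheduler_optimal d_vals.
- split=> [|k k_lt].
    apply: leq_trans (scheduler_table_size w n_gt0 m_gt0 d_vals) _.
    by rewrite leq_mul2r; apply/orP; right; nia.
  apply: leq_trans (scheduler_entry_time n_gt0 m_gt0 d_vals k_lt) _.
  by rewrite leq_mul2r; apply/orP; right; nia.
- apply: leq_trans (scheduler_outer_time w n_gt0 m_gt0 d_vals) _.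
  by rewrite leq_mul2r; apply/orP; right; nia.
exact: scheduler_total_time n_gt0 m_gt0 d_vals halpha.
Qed.
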